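(* Let $R$ be a commutative Noetherian ring with identity and let $k,l,g\ge 0$ be integers. Then the $\mathbf{CQuiver}_{\le g}^{\mathrm{op}}$-module $$\mathrm{MH}^k_l(-;R)\colon\mathbf{CQuiver}_{\le g}^{\mathrm{op}}\to\mathbf{Mod}_R$$ given by magnitude cohomology is finitely generated.
   Context: A (finite) quiver $Q$ consists of finite sets $V(Q)$ (vertices), $E(Q)$ (edges) and maps $s,t\colon E(Q)\to V(Q)$ (source, target). Its geometric realization $|Q|$ is the 1-dimensional CW complex with a 0-cell for each vertex and a 1-cell for each edge. $Q$ is connected if $|Q|$ is; the genus of $Q$ is the first Betti number of $|Q|$; a directed tree is a quiver with contractible geometric realization. A contraction $\phi\colon Q'\to Q$ is a map of sets $\phi\colon V(Q')\sqcup E(Q')\to V(Q)\sqcup E(Q)$ such that: $\phi(V(Q'))=V(Q)$; for each $e\in E(Q')$, either $\phi(e)=\phi(s(e))=\phi(t(e))$ is a vertex of $Q$, or $\phi(e)$ is an edge of $Q$ with source $\phi(s(e))$ and target $\phi(t(e))$; $\phi$ restricts to a bijection $\phi^{-1}(E(Q))\to E(Q)$; and for each vertex $v$ of $Q$ the preimage $\phi^{-1}(v)$, regarded as a subquiver of $Q'$, is a directed tree. $\mathbf{CQuiver}_{\le g}$ is the category of connected finite quivers of genus at most $g$ and contractions (including isomorphisms). Magnitude cohomology. For vertices $v,w$ of $Q$, $d(v,w)$ is the minimal number of edges of a directed path from $v$ to $w$ ($d(v,v)=0$, and $d(v,w)=\infty$ if there is no directed path). For a tuple $(v_0,\dots,v_k)$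 with $v_i\ne v_{i+1}$ and $d(v_i,v_{i+1})<\infty$ for all $i$, put $\ell(v_0,\dots,v_k)=\sum_{i=0}^{k-1}d(v_i,v_{i+1})$. $\mathrm{MC}_{k,l}(Q;R)$ is the free $R$-module on such tuples with $\ell(v_0,\dots,v_k)=l$, with differential $\delta=\sum_{i=1}^{k-1}(-1)^i\delta_i\colon \mathrm{MC}_{k,l}\to\mathrm{MC}_{k-1,l}$, where $\delta_i(v_0,\dots,v_k)=(v_0,\dots,v_{i-1},v_{i+1},\dots,v_k)$ if this tuple has length $l$ (and no two equal consecutive entries), and $0$ otherwise. $\mathrm{MH}^k_l(Q;R)$ is the $k$-th cohomology of the dual cochain complex $\mathrm{Hom}_R(\mathrm{MC}_{*,l}(Q;R),R)$. A contraction $\phi\colon Q'\to Q$ induces a chain map $\phi_\#\colon\mathrm{MC}_{*,l}(Q';R)\to\mathrm{MC}_{*,l}(Q;R)$, $(v_0,\dots,v_k)\mapsto(\phi(v_0),\dots,\phi(v_k))$ if the latter has length equal to $\ell(v_0,\dots,v_k)$, and $0$ otherwise; dualizing makes $\mathrm{MH}^k_l(-;R)$ a functor on $\mathbf{CQuiver}_{\le g}^{\mathrm{op}}$. For an essentially small category $\mathbf C$, a $\mathbf C$-module over $R$ is a functor $\mathcal M\colon\mathbf C\to\mathbf{Mod}_R$; it is finitely generated if there is a finite subset $S\subseteq\bigoplus_{c}\mathcal M(c)$ such that the smallest subfunctor of $\mathcal M$ (with values $R$-submodules) containing $S$ is $\mathcal M$. *)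

(* Defs.v *)
From HB Require Import structures.
From mathcomp Require Import all_boot all_order all_algebra.
From mathcomp Require Import generic_quotient ring_quotient.
From mathcomp Require Import boolp classical_sets functions cardinality.

Set Implicit Arguments.
Unset Strict Implicit.
Unset Printing Implicit Defensive.
Import GRing.Theory.
Local Open Scope classical_set_scope.
Local Open Scope ring_scope.
Local Open Scope quotient_scope.

Section Submodules.
Variables (R : comPzRingType) (W : lmodType R).

Record submodule := Submodule {
  submod_carrier :> W -> Prop;
  submod0 : submod_carrier 0;
  submodD : forall x y,
    submod_carrier x -> submod_carrier y -> submod_carrier (x + y);
  submodZ : forall a x, submod_carrier x -> submod_carrier (a *: x) }.

Definition submod_pred (S : submodule) : {pred W} := fun x => `[< S x >].

Lemma submod_predP (S : submodule) x : reflect (S x) (x \in submod_pred S).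
Proof. exact: asboolP. Qed.

Fact submod_pred_closed (S : submodule) : submod_closed (submod_pred S).
Proof.
split=> [|a x y /submod_predP Sx /submod_predP Sy]; apply/submod_predP.
  exact: submod0.
by apply: submodD => //; apply: submodZ.
Qed.

HB.instance Definition _ S :=
  GRing.isSubmodClosed.Build R W (submod_pred S) (submod_pred_closed S).

Record submod_type (S : submodule) := SubmodElt {
  submod_val :> W; submod_valP : submod_val \in submod_pred S }.

Section SubmodType.
Variable S : submodule.
HB.instance Definition _ := [isSub for @submod_val S].
HB.instance Definition _ := [Choice of submod_type S by <:].
HB.instance Definition _ := [SubChoice_isSubLmodule of submod_type S by <:].
End SubmodType.

Section QuotientModule.
Variable S : submodule.

Definition quotient_module := Quotient.quot (submod_pred S).
HB.instance Definition _ := Choice.on quotient_module.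
HB.instance Definition _ := GRing.Zmodule.on quotient_module.

Definition quot_proj (x : W) : quotient_module := \pi x.

Lemma quot_projP x y : quot_proj x = quot_proj y <-> S (x - y).
Proof.
rewrite /quot_proj; split=> [/eqP|Sxy].
  by rewrite -Quotient.idealrBE => /submod_predP.
by apply/eqP; rewrite -Quotient.idealrBE; apply/submod_predP.
Qed.

Lemma quot_projK (x : quotient_module) : quot_proj (repr x) = x.
Proof. exact: reprK. Qed.

Lemma quot_projD x y : quot_proj (x + y) = quot_proj x + quot_proj y.
Proof. by rewrite /quot_proj !piE. Qed.

Definition quot_scale (a : R) (x : quotient_module) : quotient_module :=
  quot_proj (a *: repr x).

Lemma quot_scale_proj a x : quot_scale a (quot_proj x) = quot_proj (a *: x).
Proof.
apply/quot_projP; rewrite -scalerBr; apply: submodZ.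
by apply/quot_projP; rewrite quot_projK.
Qed.

Fact quot_scaleA a b x : quot_scale a (quot_scale b x) = quot_scale (a * b) x.
Proof. by rewrite -[x]quot_projK !quot_scale_proj scalerA. Qed.
Fact quot_scale1 : left_id 1 quot_scale.
Proof. by move=> x; rewrite -[x]quot_projK quot_scale_proj scale1r. Qed.
Fact quot_scaleDr : right_distributive quot_scale +%R.
Proof.
move=> a x y; rewrite -[x]quot_projK -[y]quot_projK -quot_projD.
by rewrite !quot_scale_proj -quot_projD scalerDr.
Qed.
Fact quot_scaleDl x : {morph quot_scale^~ x : a b / a + b}.
Proof.
by move=> a b; rewrite -[x]quot_projK !quot_scale_proj -quot_projD scalerDl.
Qed.

HB.instance Definition _ := GRing.Zmodule_isLmodule.Build R quotient_module
  quot_scaleA quot_scale1 quot_scaleDr quot_scaleDl.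

Fact quot_proj_is_linear : linear quot_proj.
Proof. by move=> a x y; rewrite quot_projD -quot_scale_proj. Qed.
HB.instance Definition _ :=
  GRing.isLinear.Build R W quotient_module *:%R quot_proj quot_proj_is_linear.

End QuotientModule.
End Submodules.

Definition noetherian (R : comPzRingType) : Prop :=
  forall I : submodule (R^o : lmodType R),
  exists (n : nat) (x : 'I_n -> R),
    forall y, I y <-> exists a : 'I_n -> R, y = \sum_(i < n) a i * x i.

Section Dual.
Variable R : comPzRingType.

Definition dual (U : lmodType R) := {linear U -> R^o}.

Section DualModule.
Variable U : lmodType R.

HB.instance Definition _ := gen_eqMixin (dual U).
HB.instance Definition _ := gen_choiceMixin (dual U).

Lemma dualP (f g : dual U) : f =1 g -> f = g.
Proof.
case: f g => [f cf] [g cg] /= /funext fg.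
rewrite /= in fg *. subst g; congr (GRing.Linear.Pack _).
case: cf cg => [[a] [b]] [[c] [d]].
by rewrite (Prop_irrelevance a c) (Prop_irrelevance b d).
Qed.

Definition dual_zero : dual U := \0.
Definition dual_add (f g : dual U) : dual U := f \+ g.
Definition dual_opp (f : dual U) : dual U := \- f.
Definition dual_scale (a : R) (f : dual U) : dual U := a \*: f.

Fact dual_addA : associative dual_add.
Proof. by move=> f g h; apply: dualP => x /=; rewrite addrA. Qed.
Fact dual_addC : commutative dual_add.
Proof. by move=> f g; apply: dualP => x /=; rewrite addrC. Qed.
Fact dual_add0 : left_id dual_zero dual_add.
Proof. by move=> f; apply: dualP => x /=; rewrite add0r. Qed.
Fact dual_addN : left_inverse dual_zero dual_opp dual_add.
Proof. by move=> f; apply: dualP => x /=; rewrite addNr. Qed.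
HB.instance Definition _ :=
  GRing.isZmodule.Build (dual U) dual_addA dual_addC dual_add0 dual_addN.

Fact dual_scaleA a b f : dual_scale a (dual_scale b f) = dual_scale (a * b) f.
Proof. by apply: dualP => x /=; rewrite scalerA. Qed.
Fact dual_scale1 : left_id 1 dual_scale.
Proof. by move=> f; apply: dualP => x /=; rewrite scale1r. Qed.
Fact dual_scaleDr : right_distributive dual_scale +%R.
Proof. by move=> a f g; apply: dualP => x /=; rewrite scalerDr. Qed.
Fact dual_scaleDl f : {morph dual_scale^~ f : a b / a + b}.
Proof. by move=> a b; apply: dualP => x /=; rewrite scalerDl. Qed.
HB.instance Definition _ := GRing.Zmodule_isLmodule.Build R (dual U)
  dual_scaleA dual_scale1 dual_scaleDr dual_scaleDl.

End DualModule.

Definition dual_map (U V : lmodType R) (f : {linear U -> V}) (h : dual V) :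
  dual U := h \o f.

Fact dual_map_is_linear (U V : lmodType R) (f : {linear U -> V}) :
  linear (dual_map f).
Proof. by move=> a g h; apply: dualP. Qed.
HB.instance Definition _ (U V : lmodType R) (f : {linear U -> V}) :=
  GRing.isLinear.Build R (dual V) (dual U) *:%R (dual_map f)
    (dual_map_is_linear f).
End Dual.

(* [subquotient Z B] is Z / (Z :&: B), which is Z / B when B is contained
   in Z. *)
Section Subquotient.
Variable R : comPzRingType.

Section Objects.
Variables (W : lmodType R) (Z B : submodule W).

Definition trace_submodule : submodule (submod_type Z).
Proof.
apply: (@Submodule _ _ (fun z : submod_type Z => B (val z))).
- exact: submod0.
- by move=> x y Bx By; rewrite raddfD; apply: submodD.
- by move=> a x Bx; rewrite linearZ; apply: submodZ.
Defined.

Definition subquotient : lmodType R := quotient_module trace_submodule.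

Definition subquot_class (z : submod_type Z) : subquotient :=
  quot_proj trace_submodule z.

Lemma subquot_classP x y :
  subquot_class x = subquot_class y <-> B (val x - val y).
Proof. by rewrite -raddfB; apply: quot_projP. Qed.

Lemma subquot_ind (P : subquotient -> Prop) :
  (forall z, P (subquot_class z)) -> forall x, P x.
Proof.
by move=> hP x; rewrite -[x](@quot_projK _ _ trace_submodule); apply: hP.
Qed.

Lemma subquot_class_linear : linear subquot_class.
Proof. by move=> a x y; rewrite /subquot_class linearP. Qed.
End Objects.

Section Maps.
Variables (W W' : lmodType R) (Z B : submodule W) (Z' B' : submodule W').
Variable f : {linear W -> W'}.
Hypotheses (fZ : forall x, Z x -> Z' (f x)) (fB : forall x, B x -> B' (f x)).

Fact submod_map_subproof (z : submod_type Z) : f (val z) \in submod_pred Z'.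
Proof. by apply/submod_predP/fZ/submod_predP/(valP z). Qed.

Definition submod_map (z : submod_type Z) : submod_type Z' :=
  SubmodElt (submod_map_subproof z).

Definition subquot_map (x : subquotient Z B) : subquotient Z' B' :=
  subquot_class B' (submod_map (repr (x : quotient_module _))).

Lemma subquot_mapE z :
  subquot_map (subquot_class B z) = subquot_class B' (submod_map z).
Proof.
apply/subquot_classP; rewrite /= -raddfB; apply: fB.
by apply/subquot_classP; rewrite /subquot_class quot_projK.
Qed.

Fact subquot_map_is_linear : linear subquot_map.
Proof.
move=> a; elim/subquot_ind=> x; elim/subquot_ind=> y.
rewrite -subquot_class_linear !subquot_mapE -subquot_class_linear.
by congr (subquot_class _ _); apply: val_inj; rewrite /= linearP.
Qed.
End Maps.
End Subquotient.

Record category := Category {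
  obj :> Type;
  hom : obj -> obj -> Type;
  cat_id : forall a, hom a a;
  cat_comp : forall a b c, hom b c -> hom a b -> hom a c;
  cat_idl : forall a b (f : hom a b), cat_comp (cat_id b) f = f;
  cat_idr : forall a b (f : hom a b), cat_comp f (cat_id a) = f;
  cat_assoc : forall a b c d (f : hom c d) (g : hom b c) (h : hom a b),
    cat_comp f (cat_comp g h) = cat_comp (cat_comp f g) h }.

Definition opposite (C : category) : category :=
  @Category C (fun a b => hom b a) (@cat_id C) (fun a b c f g => cat_comp g f)
    (fun a b => @cat_idr C b a) (fun a b => @cat_idl C b a)
    (fun a b c d f g h => esym (cat_assoc h g f)).

Record cmodule (C : category) (R : comPzRingType) := CModule {
  cmod_obj :> C -> lmodType R;
  cmod_map : forall a b, hom a b -> {linear cmod_obj a -> cmod_obj b};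
  cmod_map_id : forall a x, cmod_map (cat_id a) x = x;
  cmod_map_comp : forall a b c (f : hom b c) (g : hom a b) x,
    cmod_map (cat_comp f g) x = cmod_map f (cmod_map g x) }.

Section FinitelyGenerated.
Variables (C : category) (R : comPzRingType) (M : cmodule C R).

(* The sum is over all objects rather than over a set of representatives of
   the isomorphism classes; for an essentially small category this does not
   affect finite generation.  [ds_finite] says that the support is finite. *)
Record direct_sum := DirectSum {
  ds_val :> forall c, M c;
  ds_finite : exists (n : nat) (s : 'I_n -> C),
    forall c, ds_val c <> 0 -> exists i, s i = c }.

Record subfunctor := Subfunctor {
  subf_obj :> forall c, submodule (M c);
  subf_map : forall a b (f : hom a b) x,
    subf_obj a x -> subf_obj b (cmod_map M f x) }.

Definition subf_contains (N : subfunctor) (S : direct_sum -> Prop) : Prop :=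
  forall x, S x -> forall c, N c (x c).

Definition generated (S : direct_sum -> Prop) (c : C) (y : M c) : Prop :=
  forall N : subfunctor, subf_contains N S -> N c y.

(* [generated S] is the smallest subfunctor containing [S]; a finite subset of
   the direct sum is given as the range of a finite family. *)
Definition finitely_generated : Prop :=
  exists (n : nat) (s : 'I_n -> direct_sum),
    forall c (y : M c), generated (fun x => exists i, s i = x) y.
End FinitelyGenerated.

Record quiver := Quiver {
  vertex : finType;
  edge : finType;
  src : edge -> vertex;
  tgt : edge -> vertex }.

(* The geometric realization |Q| enters only through its cell structure.  The
   space |Q| is connected iff it is nonempty and any two 0-cells are joined by
   an unoriented path of 1-cells.  [boundary] is the differential of the
   cellular chain complex of |Q| with rational coefficients, so that its kernel
   is H_1(|Q|; Q) and [genus] is the first Betti number.  A 1-dimensional CW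
   complex is contractible iff it is connected with vanishing H_1. *)
Section Realization.
Variable Q : quiver.

Definition adjacent : rel (vertex Q) := fun x y =>
  [exists e : edge Q, ((src e == x) && (tgt e == y)) ||
                      ((src e == y) && (tgt e == x))].

Definition connected : bool :=
  (0 < #|vertex Q|)%N && [forall x, forall y, connect adjacent x y].

Definition boundary (c : {ffun edge Q -> rat^o}) : {ffun vertex Q -> rat^o} :=
  [ffun v => \sum_e c e * ((tgt e == v)%:R - (src e == v)%:R)].

Fact boundary_is_linear : linear boundary.
Proof.
move=> a b c; apply/ffunP=> v; rewrite !ffunE scaler_sumr -big_split /=.
apply: eq_bigr => e _; rewrite !ffunE mulrDl; congr (_ + _).
by rewrite -scalerAl.
Qed.
HB.instance Definition _ := GRing.isLinear.Build rat {ffun edge Q -> rat^o}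
  {ffun vertex Q -> rat^o} *:%R boundary boundary_is_linear.

Definition genus : nat := \dim (lker (linfun boundary)).

Definition directed_tree : bool := connected && (genus == 0%N).

Lemma genus_eq0P : reflect (forall c, boundary c = 0 -> c = 0) (genus == 0%N).
Proof.
rewrite /genus dimv_eq0; apply: (iffP eqP) => [k0 c bc0|h].
  by apply/eqP; rewrite -memv0 -k0 memv_ker lfunE /= bc0.
apply/vspaceP => c; rewrite memv_ker memv0 lfunE /=.
by apply/eqP/eqP=> [/h|->]; rewrite ?linear0.
Qed.
End Realization.

Definition cell (Q : quiver) : Type := (vertex Q + edge Q)%type.

Section Fibers.
Variables (Q' Q : quiver) (phi : cell Q' -> cell Q).

Definition edge_compatible : Prop := forall e : edge Q',
  match phi (inr e) with
  | inl v => phi (inl (src e)) = inl v /\ phi (inl (tgt e)) = inl v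
  | inr e0 => phi (inl (src e)) = inl (src e0) /\
              phi (inl (tgt e)) = inl (tgt e0)
  end.

Hypothesis phiE : edge_compatible.
Variable w : vertex Q.

Definition fiber_vertex := {v : vertex Q' | phi (inl v) == inl w}.
Definition fiber_edge := {e : edge Q' | phi (inr e) == inl w}.

Fact fiber_srcP (e : fiber_edge) : phi (inl (src (val e))) == inl w.
Proof. by have := phiE (val e); rewrite (eqP (valP e)) => -[-> _]. Qed.
Fact fiber_tgtP (e : fiber_edge) : phi (inl (tgt (val e))) == inl w.
Proof. by have := phiE (val e); rewrite (eqP (valP e)) => -[_ ->]. Qed.

Definition fiber : quiver :=
  @Quiver fiber_vertex fiber_edge
    (fun e => Sub (src (val e)) (fiber_srcP e))
    (fun e => Sub (tgt (val e)) (fiber_tgtP e)).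

Let fv x (xP : phi (inl x) == inl w) : vertex fiber :=
  exist (fun v => phi (inl v) == inl w) x xP.
Let fe x (xP : phi (inr x) == inl w) : edge fiber :=
  exist (fun v => phi (inr v) == inl w) x xP.

Definition fiber_adjacent : rel (vertex Q') := fun x y =>
  [exists e : edge Q', (phi (inr e) == inl w) &&
    (((src e == x) && (tgt e == y)) || ((src e == y) && (tgt e == x)))].

Lemma fiber_connectedP :
  connected fiber <->
    (exists v, phi (inl v) = inl w) /\
    forall x y, phi (inl x) = inl w -> phi (inl y) = inl w ->
      connect fiber_adjacent x y.
Proof.
split=> [/andP[/card_gt0P[v _] /'forall_forallP cn]|[[v0 v0P] cn]].
  split=> [|x y /eqP xP /eqP yP]; first by exists (val v); apply/eqP/(valP v).
  have /connectP[p] := cn (fv xP) (fv yP).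
  elim: p x xP => [|[z zP] p IHp] x xP /=; first by move=> _ [->].
  move=> /andP[/existsP[e exz] pth] lst.
  apply: connect_trans (IHp _ zP pth lst); apply: connect1.
  by apply/existsP; exists (val e); rewrite (valP e).
apply/andP; split.
  by apply/card_gt0P; exists (fv (introT eqP v0P)).
apply/'forall_forallP=> -[x xP] [y yP].
have /connectP[p pth lst] := cn _ _ (eqP xP) (eqP yP).
elim: p x xP pth lst => [|z p IHp] x xP /=.
  move=> _ lst; rewrite -/(fv xP) -/(fv yP).
  by have -> : fv xP = fv yP by apply: val_inj.
move=> /andP[/existsP[e /andP[eP exz]] pth] lst.
have zP : phi (inl z) == inl w.
  have := phiE e; rewrite (eqP eP) => -[sP tP].
  by case/orP: exz => /andP[/eqP e1 /eqP e2]; rewrite -?e1 -?e2; apply/eqP.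
apply: connect_trans (IHp z zP pth lst); apply: connect1.
by apply/existsP; exists (fe eP).
Qed.

Lemma fiber_acyclicP :
  genus fiber == 0%N <->
    forall c : {ffun edge Q' -> rat^o},
      (forall e, c e != 0 -> phi (inr e) = inl w) -> boundary c = 0 -> c = 0.
Proof.
split=> [/genus_eq0P h c cP bc0|h].
  pose c1 : {ffun edge fiber -> rat^o} := [ffun e => c (val e)].
  have sumE v : \sum_e c e * ((tgt e == v)%:R - (src e == v)%:R) =
      \sum_(e : edge fiber) c1 e * ((tgt (val e) == v)%:R - (src (val e) == v)%:R).
    rewrite (bigID (fun e => phi (inr e) == inl w)) /= [X in _ + X]big1 ?addr0.
      rewrite (reindex_omap val (insub : edge Q' -> option fiber_edge)) /=.
        apply: eq_big => [e|e _]; last by rewrite ffunE.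
        by rewrite (valP e) valK eqxx.
      by move=> e eP; rewrite insubT.
    by move=> e eP; case: eqVneq (cP e) => [->|_ /(_ isT)/eqP] //;
      rewrite ?mul0r // (negPf eP).
  have c10 : c1 = 0.
    apply: h; apply/ffunP=> v; rewrite [LHS]ffunE [RHS]ffunE.
    have /ffunP/(_ (val v)) := bc0; rewrite !ffunE sumE => bv; apply: etrans bv.
    exact: eq_bigr.
  apply/ffunP=> e; rewrite ffunE; apply/eqP; apply: contraT => ce.
  have eP : phi (inr e) == inl w by apply/eqP/cP.
  by have /ffunP/(_ (fe eP)) := c10; rewrite !ffunE /= => /eqP; rewrite (negPf ce).
apply/genus_eq0P => c bc0.
pose c1 : {ffun edge Q' -> rat^o} :=
  [ffun e => if insub e is Some e' then c (e' : fiber_edge) else 0].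
have c10 : c1 = 0.
  apply: h => [e|]; first by rewrite ffunE; case: insubP => [? /eqP|]; rewrite ?eqxx.
  apply/ffunP=> v; rewrite !ffunE.
  rewrite (bigID (fun e => phi (inr e) == inl w)) /= [X in _ + X]big1 ?addr0; last first.
    by move=> e eP; rewrite ffunE insubN // mul0r.
  rewrite (reindex_omap val (insub : edge Q' -> option fiber_edge)) /=; last first.
    by move=> e eP; rewrite insubT.
  have [vP|vP] := boolP (phi (inl v) == inl w).
    have /ffunP/(_ (fv vP)) := bc0; rewrite !ffunE => bv; apply: etrans bv.
    apply: eq_big => [e|e _]; first by rewrite (valP e) valK eqxx.
    by rewrite ffunE valK.
  apply: big1 => e _.
  have -> : (tgt (val e) == v) = false.
    by apply: contraNF vP => /eqP <-; apply: fiber_tgtP.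
  have -> : (src (val e) == v) = false.
    by apply: contraNF vP => /eqP <-; apply: fiber_srcP.
  by rewrite subrr mulr0.
apply/ffunP=> e; have /ffunP/(_ (val e)) := c10.
by rewrite !ffunE valK.
Qed.
End Fibers.

Record contraction (Q' Q : quiver) := Contraction {
  cmap :> cell Q' -> cell Q;
  cmap_vertex : cmap @` range inl = range inl;
  cmap_edge : edge_compatible cmap;
  cmap_bij : set_bij (cmap @^-1` range inr) (range inr) cmap;
  cmap_fiber : forall v, directed_tree (fiber cmap_edge v) }.

Lemma contractionP Q' Q (f g : contraction Q' Q) : cmap f =1 cmap g -> f = g.
Proof.
case: f g => [f f1 f2 f3 f4] [g g1 g2 g3 g4] /= /funext fg; subst g.
by rewrite (Prop_irrelevance f1 g1) (Prop_irrelevance f3 g3);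
  move: f4 g4; rewrite (Prop_irrelevance f2 g2) => f4 g4;
  rewrite (Prop_irrelevance f4 g4).
Qed.

Section ContractionTheory.
Variables (Q' Q : quiver) (f : contraction Q' Q).

Fact vmap_subproof v : exists w, f (inl v) = inl w.
Proof.
have : (f @` range inl) (f (inl v)) by do 2!eexists.
by rewrite cmap_vertex => -[w _ <-]; exists w.
Qed.

Definition vmap (v : vertex Q') : vertex Q := projT1 (cid (vmap_subproof v)).

Lemma vmapE v : f (inl v) = inl (vmap v).
Proof. exact: projT2 (cid (vmap_subproof v)). Qed.

Lemma vmap_surj w : exists v, vmap v = w.
Proof.
have : (f @` range inl) (inl w) by rewrite cmap_vertex; exists w.
by case=> _ [v _ <-]; rewrite vmapE => -[<-]; exists v.
Qed.

Lemma edge_lift (e : edge Q) : exists e', f (inr e') = inr e.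
Proof.
have [_ _ /(_ (inr e) _)[]] := cmap_bij f; first by exists e.
by move=> [v|e'] _ //; [rewrite vmapE | exists e'].
Qed.

Lemma edge_lift_uniq e1 e2 e : f (inr e1) = inr e -> f (inr e2) = inr e -> e1 = e2.
Proof.
move=> h1 h2; have [_ inj _] := cmap_bij f.
suff [] : inr e1 = inr e2 :> cell Q' by [].
by apply: inj; rewrite ?inE /= ?h1 ?h2 //; exists e.
Qed.

Lemma edge_contracted e w :
  f (inr e) = inl w -> vmap (src e) = w /\ vmap (tgt e) = w.
Proof. by move=> h; have := cmap_edge f e; rewrite h !vmapE => -[[->][->]]. Qed.

Lemma edge_kept e e0 :
  f (inr e) = inr e0 -> vmap (src e) = src e0 /\ vmap (tgt e) = tgt e0.
Proof. by move=> h; have := cmap_edge f e; rewrite h !vmapE => -[[->][->]]. Qed.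

Lemma fiber_connect w x y : vmap x = w -> vmap y = w ->
  connect (fiber_adjacent f w) x y.
Proof.
move=> xw yw; have /andP[/fiber_connectedP[_ h] _] := cmap_fiber f w.
by apply: h; rewrite vmapE (xw, yw).
Qed.

Lemma fiber_acyclic w (c : {ffun edge Q' -> rat^o}) :
  (forall e, c e != 0 -> f (inr e) = inl w) -> boundary c = 0 -> c = 0.
Proof. by have /andP[_ /fiber_acyclicP] := cmap_fiber f w; apply. Qed.
End ContractionTheory.

Section IdContraction.
Variable Q : quiver.

Fact id_edge_compatible : @edge_compatible Q Q id.
Proof. by move=> e /=. Qed.

Fact id_bij : set_bij (@id (cell Q) @^-1` range inr) (range inr) (@id (cell Q)).
Proof. by split=> //= _ [e _ <-]; exists (inr e) => //; exists e. Qed.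

Fact id_fiber v : directed_tree (fiber id_edge_compatible v).
Proof.
apply/andP; split.
  by apply/fiber_connectedP; split=> [|x y [->] [->]]; [exists v |].
apply/fiber_acyclicP => c cP _; apply/ffunP=> e; rewrite ffunE.
by apply/eqP; apply: contraT => /cP.
Qed.

Definition id_contraction : contraction Q Q :=
  @Contraction Q Q id (image_id _) id_edge_compatible id_bij id_fiber.
End IdContraction.

Section CompContraction.
Variables (Q2 Q1 Q0 : quiver) (g : contraction Q1 Q0) (f : contraction Q2 Q1).
Let h : cell Q2 -> cell Q0 := g \o f.

Fact comp_vertex : h @` range inl = range inl.
Proof. by rewrite /h -image_comp cmap_vertex cmap_vertex. Qed.

Fact comp_edge_compatible : edge_compatible h.
Proof.
move=> e; rewrite /h /=; case fe: (f (inr e)) => [v|e1].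
  have [s t] := edge_contracted fe.
  by rewrite !vmapE s t.
have [s t] := edge_kept fe; rewrite !vmapE s t.
by have := cmap_edge g e1; rewrite !vmapE.
Qed.

Fact comp_bij : set_bij (h @^-1` range inr) (range inr) h.
Proof.
have hinr x e0 : h x = inr e0 -> exists e1 e2, [/\ x = inr e2, f (inr e2) = inr e1 & g (inr e1) = inr e0].
  case: x => [v|e2]; rewrite /h /=; first by rewrite !vmapE.
  case fe: (f (inr e2)) => [v|e1]; first by rewrite vmapE.
  by exists e1, e2.
split=> [x //|x y|_ [e0 _ <-]].
  rewrite !inE /= => -[e0 _ /esym hx] [e0' _ /esym hy] hxy.
  have [e1 [e2 [-> fe ge]]] := hinr _ _ hx.
  rewrite hxy hy in hx; case: hx => ee; rewrite ee {e0' ee} in hy.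
  have [e1' [e2' [-> fe' ge']]] := hinr _ _ hy.
  have ee := edge_lift_uniq ge ge'; rewrite -ee in fe'.
  by rewrite (edge_lift_uniq fe fe').
have [e1 ge] := edge_lift g e0; have [e2 fe] := edge_lift f e1.
by exists (inr e2); rewrite /= /h /= fe ge //; exists e0.
Qed.

Fact comp_fiber w : directed_tree (fiber comp_edge_compatible w).
Proof.
have hE v : h (inl v) = inl (vmap g (vmap f v)) by rewrite /h /= !vmapE.
apply/andP; split.
  apply/fiber_connectedP; split.
    have [v1 <-] := vmap_surj g w; have [v2 <-] := vmap_surj f v1.
    by exists v2; rewrite hE.
  have fib u x y : vmap g u = w -> vmap f x = u -> vmap f y = u ->
      connect (fiber_adjacent h w) x y.
    move=> uw xu yu; apply: connect_sub (fiber_connect xu yu) => a b.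
    move=> /existsP[e /andP[/eqP fe eab]]; apply: connect1.
    by apply/existsP; exists e; rewrite eab andbT /h /= fe vmapE uw.
  move=> x y; rewrite !hE => -[xw] [yw].
  have /connectP[p] := fiber_connect xw yw.
  move Dx: (vmap f x) => x1; rewrite Dx in xw.
  elim: p x1 x Dx xw => [|z1 p IHp] x1 x Dx xw /=.
    by move=> _ yx; apply: (fib x1).
  move=> /andP[/existsP[e1 /andP[/eqP ge1 exz]] pth] lst.
  have [sw tw] := edge_contracted ge1.
  have [e2 fe2] := edge_lift f e1; have [s2 t2] := edge_kept fe2.
  have he2 : h (inr e2) == inl w by rewrite /h /= fe2 ge1.
  case/orP: exz => /andP[/eqP s1 /eqP t1].
    apply: (connect_trans (y := src e2)); first by apply: (fib x1); rewrite ?s2.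
    apply: (connect_trans (y := tgt e2)); last first.
      by apply: (IHp z1) => //; rewrite ?t2 -?t1.
    by apply: connect1; apply/existsP; exists e2; rewrite he2 !eqxx.
  apply: (connect_trans (y := tgt e2)); first by apply: (fib x1); rewrite ?t2.
  apply: (connect_trans (y := src e2)); last first.
    by apply: (IHp z1) => //; rewrite ?s2 -?s1.
  by apply: connect1; apply/existsP; exists e2; rewrite he2 !eqxx orbT.
apply/fiber_acyclicP => c cP bc0.
pose inc (e : edge Q2) (v : vertex Q2) : rat := (tgt e == v)%:R - (src e == v)%:R.
have bcE v : \sum_e c e * inc e v = 0.
  by have /ffunP/(_ v) := bc0; rewrite !ffunE.
pose c1 : {ffun edge Q1 -> rat^o} :=
  [ffun e1 => \sum_(e | f (inr e) == inr e1) c e].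
have c1E e e1 : f (inr e) = inr e1 -> c1 e1 = c e.
  move=> fe; rewrite ffunE (big_pred1 e) // => e'.
  by apply/eqP/eqP=> [fe'|->//]; apply: edge_lift_uniq fe' fe.
have sumv e v1 : \sum_(v | vmap f v == v1) inc e v =
    (vmap f (tgt e) == v1)%:R - (vmap f (src e) == v1)%:R.
  rewrite sumrB; congr (_ - _).
    rewrite (big_mkcond (fun v => vmap f v == v1)) (bigD1 (tgt e)) //= eqxx big1 ?addr0.
      by case: ifP.
    by move=> v; rewrite eq_sym => /negPf ->; case: ifP.
  rewrite (big_mkcond (fun v => vmap f v == v1)) (bigD1 (src e)) //= eqxx big1 ?addr0.
    by case: ifP.
  by move=> v; rewrite eq_sym => /negPf ->; case: ifP.
have c10 : c1 = 0.
  apply: (@fiber_acyclic _ _ g w) => [e1|].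
    have [e2 fe2] := edge_lift f e1; rewrite (c1E e2) // => /cP.
    by rewrite /h /= fe2.
  apply/ffunP=> v1; rewrite [LHS]ffunE [RHS]ffunE.
  have bv : \sum_(v | vmap f v == v1) \sum_e c e * inc e v = 0.
    by rewrite big1 // => v _; apply: bcE.
  apply: etrans bv; rewrite exchange_big /=.
  under [RHS]eq_bigr => e _ do rewrite -mulr_sumr sumv.
  under [LHS]eq_bigr => e1 _ do rewrite ffunE mulr_suml.
  rewrite (exchange_big_dep predT) //=; apply: eq_bigr => e _.
  case fe: (f (inr e)) => [u|e1].
    have [-> ->] := edge_contracted fe; rewrite subrr mulr0 big_pred0 //.
  have [-> ->] := edge_kept fe; by rewrite (big_pred1 e1).
have kept0 e e1 : f (inr e) = inr e1 -> c e = 0.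
  by move=> fe; rewrite -(c1E _ _ fe) c10 ffunE.
apply/ffunP=> e; rewrite ffunE.
case fe: (f (inr e)) => [u|e1]; last exact: kept0 fe.
pose c2 : {ffun edge Q2 -> rat^o} := [ffun e' => if f (inr e') == inl u then c e' else 0].
suff c20 : c2 = 0.
  by have /ffunP/(_ e) := c20; rewrite !ffunE fe eqxx.
apply: (@fiber_acyclic _ _ f u) => [e'|].
  by rewrite ffunE; case: ifP => [/eqP //|_]; rewrite eqxx.
apply/ffunP=> v; rewrite [LHS]ffunE [RHS]ffunE.
have [vu|vu] := eqVneq (vmap f v) u.
  apply: etrans (bcE v); apply: eq_bigr => e' _; rewrite ffunE.
  case: ifPn => // fe'; rewrite mul0r.
  case fe2: (f (inr e')) => [u'|e1']; last by rewrite (kept0 _ _ fe2) mul0r.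
  have [s t] := edge_contracted fe2; rewrite /inc.
  have uu : u' != u by apply: contraNneq fe' => <-; rewrite fe2.
  have -> : (tgt e' == v) = false.
    by apply: contraNF uu => /eqP tv; rewrite -t tv vu.
  have -> : (src e' == v) = false.
    by apply: contraNF uu => /eqP sv; rewrite -s sv vu.
  by rewrite subrr mulr0.
apply: big1 => e' _; rewrite ffunE; case: ifP => [/eqP fe'|_]; last by rewrite mul0r.
have [s t] := edge_contracted fe'.
have -> : (tgt e' == v) = false by apply: contraNF vu => /eqP <-; rewrite t.
have -> : (src e' == v) = false by apply: contraNF vu => /eqP <-; rewrite s.
by rewrite subrr mulr0.
Qed.

Definition comp_contraction : contraction Q2 Q0 :=
  Contraction comp_vertex comp_bij comp_fiber.

Lemma vmap_comp v : vmap comp_contraction v = vmap g (vmap f v).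
Proof.
have e : comp_contraction (inl v) = g (f (inl v)) by [].
by move: e; rewrite (vmapE comp_contraction) (vmapE f) (vmapE g) => -[].
Qed.
End CompContraction.

Record cquiver (g : nat) := CQuiver {
  cquiver_val :> quiver;
  cquiver_connected : connected cquiver_val;
  cquiver_genus : (genus cquiver_val <= g)%N }.

Section QuiverCategory.
Variable g : nat.
Let Hom (Q' Q : cquiver g) := contraction Q' Q.

Fact contraction_idl (Q' Q : cquiver g) (f : Hom Q' Q) :
  comp_contraction (id_contraction Q) f = f.
Proof. exact: contractionP. Qed.
Fact contraction_idr (Q' Q : cquiver g) (f : Hom Q' Q) :
  comp_contraction f (id_contraction Q') = f.
Proof. exact: contractionP. Qed.
Fact contraction_assoc (Q3 Q2 Q1 Q0 : cquiver g)
    (f : Hom Q1 Q0) (h : Hom Q2 Q1) (k : Hom Q3 Q2) :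
  comp_contraction f (comp_contraction h k) =
  comp_contraction (comp_contraction f h) k.
Proof. exact: contractionP. Qed.

Definition CQuiver_category : category :=
  @Category (cquiver g) Hom (fun Q => id_contraction Q)
    (fun _ _ _ => @comp_contraction _ _ _)
    contraction_idl contraction_idr contraction_assoc.
End QuiverCategory.

Section LinearExtension.
Variables (R : comPzRingType) (X : finType) (W : lmodType R).

Definition lin_ext (f : X -> W) (c : {ffun X -> R^o}) : W := \sum_x c x *: f x.

Fact lin_ext_is_linear f : linear (lin_ext f).
Proof.
move=> a b c; rewrite /lin_ext scaler_sumr -big_split /=.
by apply: eq_bigr => x _; rewrite !ffunE scalerDl scalerA.
Qed.
HB.instance Definition _ f := GRing.isLinear.Build R {ffun X -> R^o} W *:%R
  (lin_ext f) (lin_ext_is_linear f).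

Definition delta (x : X) : {ffun X -> R^o} := [ffun y => (y == x)%:R].

Lemma lin_ext_delta f x : lin_ext f (delta x) = f x.
Proof.
rewrite /lin_ext (bigD1 x) //= ffunE eqxx scale1r big1 ?addr0 // => y yx.
by rewrite ffunE (negPf yx) scale0r.
Qed.

Lemma delta_sum (c : {ffun X -> R^o}) : c = \sum_x c x *: delta x.
Proof.
apply/ffunP=> y; rewrite sum_ffunE (bigD1 y) //= big1 ?addr0 => [|x xy].
  by rewrite !ffunE eqxx; rewrite /GRing.scale /= mulr1.
by rewrite !ffunE eq_sym (negPf xy) /GRing.scale /= mulr0.
Qed.

Lemma eq_linear_delta (f g : {linear {ffun X -> R^o} -> W}) :
  (forall x, f (delta x) = g (delta x)) -> f =1 g.
Proof.
move=> fg c; rewrite (delta_sum c) !linear_sum; apply: eq_bigr => x _.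
by rewrite !linearZ /= fg.
Qed.
End LinearExtension.

Section Distance.
Variable Q : quiver.
Implicit Types (v w : vertex Q) (s : seq (vertex Q)).

Fixpoint directed_path v (p : seq (edge Q)) w : bool :=
  if p is e :: p' then (src e == v) && directed_path (tgt e) p' w else v == w.

Definition reach (n : nat) v w : bool :=
  [exists p : n.-tuple (edge Q), directed_path v p w].

(* [None] stands for the distance infinity. *)
Definition dist v w : option nat :=
  if pselect (exists n, reach n v w) is left h then Some (ex_minn h) else None.

Definition add_inf (a b : option nat) : option nat :=
  if (a, b) is (Some m, Some n) then Some (m + n)%N else None.

Fixpoint tuple_length s : option nat :=
  if s is v :: s' then
    if s' is w :: _ then add_inf (dist v w) (tuple_length s') else Some 0%N
  else Some 0%N.

Lemma tuple_length_cons v w s :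
  tuple_length [:: v, w & s] = add_inf (dist v w) (tuple_length (w :: s)).
Proof. by []. Qed.

Definition del (T : Type) (i : nat) (s : seq T) : seq T :=
  take i s ++ drop i.+1 s.

Definition admissible (l : nat) s : bool :=
  sorted (fun v w => v != w) s && (tuple_length s == Some l).

Definition le_inf (a b : option nat) : bool :=
  if b is Some n then if a is Some m then (m <= n)%N else false else true.

Lemma le_inf_refl a : le_inf a a.
Proof. by case: a => /=. Qed.
Lemma le_inf_trans b a c : le_inf a b -> le_inf b c -> le_inf a c.
Proof. by case: a b c => [a|] [b|] [c|] //=; apply: leq_trans. Qed.
Lemma le_inf_anti a b : le_inf a b -> le_inf b a -> a = b.
Proof.
by case: a b => [a|] [b|] //= ab ba; congr Some; apply/eqP; rewrite eqn_leq ab.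
Qed.
Lemma le_inf_add a b c d :
  le_inf a b -> le_inf c d -> le_inf (add_inf a c) (add_inf b d).
Proof. by case: a b c d => [a|] [b|] [c|] [d|] //=; apply: leq_add. Qed.
Lemma add_infA : associative add_inf.
Proof. by case=> [a|] [b|] [c|] //=; congr Some; apply: addnA. Qed.

Lemma directed_path_cat u v w p q :
  directed_path u p v -> directed_path v q w -> directed_path u (p ++ q) w.
Proof.
elim: p u => [|e p IHp] u /=; first by move=> /eqP ->.
by move=> /andP[-> /IHp h] /h.
Qed.

Lemma reachP n v w :
  reflect (exists2 p, size p = n & directed_path v p w) (reach n v w).
Proof.
apply: (iffP existsP) => [[p vw]|[p /eqP sp vw]]; first by exists p; rewrite ?size_tuple.
by exists (Tuple sp).
Qed.

Lemma dist_leP v w n :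
  le_inf (dist v w) (Some n) <-> exists2 m, (m <= n)%N & reach m v w.
Proof.
rewrite /dist; case: pselect => [h|h] /=; last first.
  by split=> // -[m _ vw]; case: h; exists m.
case: ex_minnP => m vw min; split=> [mn|[k kn /min mk]]; first by exists m.
exact: leq_trans mk kn.
Qed.

Lemma dist_reach v w n : dist v w = Some n -> reach n v w.
Proof.
rewrite /dist; case: pselect => [h|h] //= [<-].
by case: ex_minnP.
Qed.

Lemma dist_triangle u v w : le_inf (dist u w) (add_inf (dist u v) (dist v w)).
Proof.
case duv: (dist u v) => [m|] //=; case dvw: (dist v w) => [n|] //=.
apply/dist_leP; exists (m + n)%N => //.
have /reachP[p <- up] := dist_reach duv; have /reachP[q <- vq] := dist_reach dvw.
by apply/reachP; exists (p ++ q); rewrite ?size_cat //; apply: directed_path_cat up vq.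
Qed.

Lemma dist_pos v w : v != w -> dist v w <> Some 0%N.
Proof.
move=> vw d0; have /reachP[[|//] _ /= /eqP e] := dist_reach d0.
by rewrite e eqxx in vw.
Qed.

Lemma distvv v : dist v v = Some 0%N.
Proof.
apply: (@le_inf_anti _ (Some _)); last by case: dist.
by apply/dist_leP; exists 0%N => //; apply/reachP; exists [::] => /=.
Qed.

Lemma size_del (T : Type) i (s : seq T) :
  (i < size s)%N -> size (del i s) = (size s).-1.
Proof.
by move=> si; rewrite /del size_cat size_take size_drop si -{2}(subnKC si) addSn.
Qed.

Lemma length_del i s : (i.+2 < size s)%N ->
  le_inf (tuple_length (del i.+1 s)) (tuple_length s).
Proof.
elim: i s => [|i IHi] [|v [|w [|x s]]] //= si.
  rewrite -/(tuple_length (x :: s)) add_infA.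
  by apply: le_inf_add (le_inf_refl _); apply: dist_triangle.
apply: le_inf_add (le_inf_refl _) _.
exact: (IHi (w :: x :: s)).
Qed.

Lemma sorted_del i s l : (i.+2 < size s)%N ->
  admissible l s -> tuple_length (del i.+1 s) = Some l ->
  admissible l (del i.+1 s).
Proof.
move=> si /andP[srt /eqP ls] ld; rewrite /admissible ld eqxx andbT.
elim: i s l si srt ls ld => [|i IHi] [|v [|w [|x s]]] //= l si.
  case/and3P=> vw _ srt; rewrite -/(tuple_length (x :: s)).
  rewrite srt andbT; case dvw: (dist v w) => [a|] //.
  case dwx: (dist w x) => [b|] //; case: (tuple_length (x :: s)) => [c|] //=.
  move=> [<-] h; apply/eqP=> vx; move: h; rewrite -vx distvv /= => -[h].
  case: (dist_pos vw); rewrite dvw; congr Some; apply/eqP.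
  by rewrite -leqn0 -(leq_add2r (b + c)) -h leq_addl.
case/andP=> vw srt; rewrite vw /=.
case: (dist v w) => [a|] //; rewrite -/(tuple_length (w :: x :: s)).
case lwx: (tuple_length (w :: x :: s)) => [b|] //= [abl] h.
apply: (IHi (w :: x :: s) b) => //.
have {h} : add_inf (Some a) (tuple_length (del i.+1 (w :: x :: s))) = Some l.
  by [].
case: (tuple_length (del _ _)) => [b'|] //= [ab'l].
by congr Some; apply/eqP; rewrite -(eqn_add2l a) ab'l abl.
Qed.
End Distance.

Section DistanceContraction.
Variables (Q' Q : quiver) (f : contraction Q' Q).

Lemma dist_map v w : le_inf (dist (vmap f v) (vmap f w)) (dist v w).
Proof.
case dvw: (dist v w) => [n|]; last by case: dist.
have /reachP[p <- {dvw}] := dist_reach dvw.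
elim: p v => [|e p IHp] v /=; first by move=> /eqP ->; rewrite distvv.
case/andP=> /eqP <- /IHp /dist_leP[m mp /reachP[q sq hq]].
apply/dist_leP.
case fe: (f (inr e)) => [u|e0].
  have [s t] := edge_contracted fe; exists m; first exact: leqW.
  by apply/reachP; exists q; rewrite // s -t.
have [s t] := edge_kept fe; exists m.+1 => //.
by apply/reachP; exists (e0 :: q); rewrite /= ?sq // s eqxx -t.
Qed.

Lemma length_map s : le_inf (tuple_length (map (vmap f) s)) (tuple_length s).
Proof.
elim: s => [|v [|w s] IHs] //; apply: le_inf_add IHs; exact: dist_map.
Qed.

Lemma admissible_map l s : admissible l s ->
  tuple_length (map (vmap f) s) = Some l -> admissible l (map (vmap f) s).
Proof.
move=> /andP[srt /eqP ls] lfs; rewrite /admissible lfs eqxx andbT.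
have : le_inf (tuple_length s) (tuple_length (map (vmap f) s)).
  by rewrite ls lfs /=.
have : tuple_length s <> None by rewrite ls.
move=> {ls lfs}.
elim: s srt => [|v [|w s] IHs] // /andP[vw srt].
have := IHs srt; have := length_map (w :: s); have := dist_map v w.
have := @dist_pos _ _ _ vw.
have -> : map (vmap f) [:: v, w & s] = [:: vmap f v, vmap f w & map (vmap f) s].
  by [].
rewrite !tuple_length_cons -[vmap f w :: _]/(map (vmap f) (w :: s)).
case: (dist v w) => [n|//]; case: (tuple_length (w :: s)) => [m|//].
case: (tuple_length (map _ _)) => [m'|]; last by rewrite /add_inf; case: dist.
case dff: (dist _ _) => [n'|//] n0 /= nn mm IH _ nm.
have mm' : (m <= m')%N by rewrite -(leq_add2l n) (leq_trans nm) ?leq_add2r.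
have nn' : (n <= n')%N by rewrite -(leq_add2r m) (leq_trans nm) ?leq_add2l.
apply/andP; split; last exact: IH.
apply: contraPneq dff => ->; rewrite distvv => -[n'0].
by apply: n0; congr Some; apply/eqP; rewrite -leqn0 n'0.
Qed.
End DistanceContraction.

Section MagnitudeComplex.
Variables (R : comPzRingType) (Q : quiver).

Definition generator (k l : nat) : finType :=
  {t : k.+1.-tuple (vertex Q) | admissible l t}.

Definition MC (k l : nat) : lmodType R := {ffun generator k l -> R^o}.

(* The basis vector given by [s] if [s] is a generator, and 0 otherwise. *)
Definition basis (k l : nat) (s : seq (vertex Q)) : MC k l :=
  [ffun t => (tval (val t) == s)%:R].

Lemma basis_delta k l (t : generator k l) : basis k l (val (val t)) = delta R t.
Proof. by apply/ffunP=> u; rewrite !ffunE. Qed.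

Lemma basis_generator k l s : size s = k.+1 -> admissible l s ->
  exists t : generator k l, val (val t) = s.
Proof.
move=> /eqP sz adm.
by exists (exist (fun t : k.+1.-tuple _ => admissible l t) (Tuple sz) adm).
Qed.

Lemma basis0 k l s : ~~ admissible l s -> basis k l s = 0.
Proof.
move=> adm; apply/ffunP=> t; rewrite !ffunE.
by case: eqP => // ts; rewrite -ts (valP t) in adm.
Qed.

(* [basis] vanishes on tuples that are not generators, so a deletion that
   changes the length contributes 0. *)
Definition differential (k l : nat) : MC k.+1 l -> MC k l :=
  lin_ext (fun t : generator k.+1 l =>
    \sum_(1 <= i < k.+1) (-1) ^+ i *: basis k l (del i (val (val t)))).
HB.instance Definition _ (k l : nat) :=
  GRing.Linear.on (@differential k l).

Lemma differential_basis k l s : size s = k.+2 -> admissible l s ->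
  differential (basis k.+1 l s) =
    \sum_(1 <= i < k.+1) (-1) ^+ i *: basis k l (del i s).
Proof.
move=> sz adm; have [t <-] := basis_generator sz adm.
by rewrite basis_delta /differential lin_ext_delta.
Qed.

Lemma del_del (T : Type) (i j : nat) (s : seq T) :
  (j <= i)%N -> del j (del i.+1 s) = del i (del j s).
Proof.
elim: j i s => [|j IHj] [|i] [|x s] //= ji.
all: try by rewrite /del /= ?take0 ?drop0.
exact: (congr1 (cons x) (IHj i s ji)).
Qed.

Lemma admissible_del_del (i j l : nat) (s : seq (vertex Q)) :
  (i.+2 < size s)%N -> (j.+3 < size s)%N -> admissible l s ->
  admissible l (del j.+1 (del i.+1 s)) -> admissible l (del i.+1 s).
Proof.
move=> si sj adm /andP[_ /eqP ld2]; apply: sorted_del => //.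
have /andP[_ /eqP ls] := adm.
apply: le_inf_anti; first by rewrite -ls length_del.
by rewrite -ld2 length_del // size_del ?(ltnW si) // -ltnS prednK // (leq_trans _ sj).
Qed.

Lemma differential_differential (k l : nat) (c : MC k.+2 l) :
  differential (differential c) = 0.
Proof.
apply: (eq_linear_delta
  (f := @differential k l \o @differential k.+1 l) (g := \0)) => t /=.
rewrite -basis_delta; set s := val (val t).
have sz : size s = k.+3 by rewrite size_tuple.
have adm : admissible l s := valP t.
have sz_del i : (1 <= i < k.+2)%N -> size (del i s) = k.+2.
  by move=> /andP[_ ik]; rewrite size_del sz // ltnW.
rewrite differential_basis // linear_sum /=.
pose G i j : MC k l := (-1) ^+ (i + j) *: basis k l (del j (del i s)).
transitivity (\sum_(1 <= i < k.+2) \sum_(1 <= j < k.+1) G i j).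
  apply: eq_big_nat => i ik; rewrite linearZ /=.
  have [admd|admd] := boolP (admissible l (del i s)).
    rewrite differential_basis ?sz_del // scaler_sumr.
    by apply: eq_bigr => j _; rewrite scalerA -exprD.
  rewrite basis0 // linear0 scaler0 big_nat big1 // => j jk.
  rewrite /G basis0 ?scaler0 //; apply: contra admd.
  case: i j ik jk => [|i] [|j] // /andP[_ ik] /andP[_ jk].
  by apply: admissible_del_del; rewrite // sz.
pose H i j : MC k l := if (i <= j)%N then G i j else 0.
have -> : \sum_(1 <= i < k.+2) \sum_(1 <= j < k.+1) G i j =
    \sum_(1 <= i < k.+2) \sum_(1 <= j < k.+1) H i j +
    \sum_(1 <= i < k.+2) \sum_(1 <= j < k.+1) (if (j < i)%N then G i j else 0).
  rewrite -big_split; apply: eq_bigr => i _ /=; rewrite -big_split.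
  by apply: eq_bigr => j _; rewrite /H /=; case: leqP; rewrite ?addr0 ?add0r.
rewrite big_nat_recr //= [X in _ + X + _]big_nat [X in _ + X + _]big1 ?addr0; last first.
  by move=> j /andP[_ jk]; rewrite /H leqNgt jk.
rewrite [X in _ + X]big_add1 /= [X in _ + X]big_ltn // [X in _ + (X + _)]big_nat.
rewrite [X in _ + (X + _)]big1 ?add0r; last by case=> // j /andP[].
rewrite [X in _ + X]exchange_big_nat /= -big_split big1 // => i _ /=.
rewrite -big_split big1 // => j _ /=; rewrite /H ltnS.
case: ifP => ij; last by rewrite addr0.
by rewrite /G del_del // addSn exprS mulN1r scaleNr addnC addrN.
Qed.

Definition coboundary (k l : nat) : dual (MC k l) -> dual (MC k.+1 l) :=
  dual_map (@differential k l).
HB.instance Definition _ (k l : nat) := GRing.Linear.on (@coboundary k l).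

Definition cocycles (k l : nat) : submodule (dual (MC k l)).
Proof.
apply: (@Submodule _ _ (fun h => coboundary h = 0)).
- exact: linear0.
- by move=> x y x0 y0; rewrite linearD /= x0 y0 addr0.
- by move=> a x x0; rewrite linearZ /= x0 scaler0.
Defined.

Definition is_coboundary (k l : nat) : dual (MC k l) -> Prop :=
  if k is k'.+1 then fun h => exists h' : dual (MC k' l), h = coboundary h'
  else fun h => h = 0.

Definition coboundaries (k l : nat) : submodule (dual (MC k l)).
Proof.
apply: (@Submodule _ _ (@is_coboundary k l)).
- by case: k => //= k; exists 0; rewrite linear0.
- case: k => [|k] x y /=; first by move=> -> ->; rewrite addr0.
  by move=> [x' ->] [y' ->]; exists (x' + y'); rewrite linearD.
- case: k => [|k] a x /=; first by move=> ->; rewrite scaler0.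
  by move=> [x' ->]; exists (a *: x'); rewrite linearZ.
Defined.

Lemma coboundaries_cocycles (k l : nat) (h : dual (MC k l)) :
  coboundaries k l h -> cocycles k l h.
Proof.
case: k h => [|k] h /=; first by move=> ->; rewrite linear0.
move=> [h' ->]; apply: dualP => c /=.
by rewrite differential_differential linear0.
Qed.

Definition MH (k l : nat) : lmodType R :=
  subquotient (cocycles k l) (coboundaries k l).
End MagnitudeComplex.

Section PushForward.
Variables (R : comPzRingType) (Q' Q : quiver) (f : contraction Q' Q).

(* The image tuple contributes 0 unless it again has length [l]. *)
Definition push (k l : nat) : MC R Q' k l -> MC R Q k l :=
  lin_ext (fun t : generator Q' k l => basis R k l (map (vmap f) (val (val t)))).
HB.instance Definition _ (k l : nat) := GRing.Linear.on (@push k l).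

Lemma push_basis k l s : size s = k.+1 ->
  push (basis R k l s) =
    if admissible l s then basis R k l (map (vmap f) s) else 0.
Proof.
move=> sz; case: ifPn => adm; last by rewrite basis0 // linear0.
have [t <-] := basis_generator sz adm.
by rewrite basis_delta /push lin_ext_delta.
Qed.

Lemma map_del (i : nat) s : map (vmap f) (del i s) = del i (map (vmap f) s).
Proof. by rewrite /del map_cat map_take map_drop. Qed.

Lemma admissible_map_del i l s : (i.+2 < size s)%N -> admissible l s ->
  admissible l (map (vmap f) (del i.+1 s)) ->
  admissible l (del i.+1 s) /\ admissible l (map (vmap f) s).
Proof.
move=> si adm /andP[_ /eqP lfd]; have /andP[_ /eqP ls] := adm.
have ld : tuple_length (del i.+1 s) = Some l.
  apply: le_inf_anti; first by rewrite -ls length_del.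
  by rewrite -lfd length_map.
have lf : tuple_length (map (vmap f) s) = Some l.
  apply: le_inf_anti; first by rewrite -ls length_map.
  by rewrite -lfd map_del length_del // size_map.
by split; [apply: sorted_del | apply: admissible_map].
Qed.

Lemma push_differential k l (c : MC R Q' k.+1 l) :
  push (differential c) = differential (push c).
Proof.
apply: (eq_linear_delta (f := @push k l \o @differential R Q' k l)
  (g := @differential R Q k l \o @push k.+1 l)) => t /=.
rewrite -basis_delta; set s := val (val t).
have sz : size s = k.+2 by rewrite size_tuple.
have adm : admissible l s := valP t.
rewrite push_basis // adm differential_basis // linear_sum /=.
have sz_del i : (1 <= i < k.+1)%N -> size (del i s) = k.+1.
  by move=> /andP[_ ik]; rewrite size_del sz // ltnW.
have [admf|admf] := boolP (admissible l (map (vmap f) s)).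
  rewrite differential_basis ?size_map //; apply: eq_big_nat => i ik.
  rewrite linearZ /= push_basis ?sz_del //; congr (_ *: _).
  case: ifPn => [_|nadm]; first by rewrite map_del.
  rewrite -map_del basis0 //; apply: contra nadm => admd.
  case: i ik admd => // i /andP[_ ik] admd.
  by have [] := admissible_map_del (i := i) _ adm admd; rewrite // sz.
rewrite (basis0 _ _ admf) linear0 big_nat big1 // => i ik.
rewrite linearZ /= push_basis ?sz_del //.
case: ifP => _; last by rewrite scaler0.
rewrite basis0 ?scaler0 //; apply: contra admf => admd.
case: i ik admd => // i /andP[_ ik] admd.
by have [] := admissible_map_del (i := i) _ adm admd; rewrite // sz.
Qed.

Definition pull (k l : nat) : dual (MC R Q k l) -> dual (MC R Q' k l) :=
  dual_map (@push k l).
HB.instance Definition _ (k l : nat) := GRing.Linear.on (@pull k l).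

Lemma pull_coboundary k l (h : dual (MC R Q k l)) :
  coboundary (pull h) = pull (coboundary h).
Proof. by apply: dualP => c /=; rewrite push_differential. Qed.

Fact pull_cocycles k l h : cocycles R Q k l h -> cocycles R Q' k l (pull h).
Proof. by rewrite /= pull_coboundary => ->; rewrite linear0. Qed.

Fact pull_coboundaries k l h :
  coboundaries R Q k l h -> coboundaries R Q' k l (pull h).
Proof.
case: k h => [|k] h /=; first by move=> ->; rewrite linear0.
by move=> [h' ->]; exists (pull h'); rewrite pull_coboundary.
Qed.

Definition MH_map (k l : nat) : MH R Q k l -> MH R Q' k l :=
  subquot_map (coboundaries R Q' k l) (f := @pull k l) (@pull_cocycles k l).
HB.instance Definition _ (k l : nat) :=
  GRing.isLinear.Build R (MH R Q k l) (MH R Q' k l) *:%R (@MH_map k l)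
    (subquot_map_is_linear (@pull_cocycles k l) (@pull_coboundaries k l)).

Lemma MH_mapE k l z :
  MH_map (subquot_class (coboundaries R Q k l) z) =
  subquot_class (coboundaries R Q' k l) (submod_map (@pull_cocycles k l) z).
Proof. by apply: subquot_mapE; apply: pull_coboundaries. Qed.
End PushForward.

Section MagnitudeFunctor.
Variables (R : comPzRingType) (k l g : nat).

Lemma push_id Q (c : MC R Q k l) : push (id_contraction Q) c = c.
Proof.
apply: (eq_linear_delta (f := @push R _ _ (id_contraction Q) k l) (g := idfun)).
move=> t /=; rewrite -basis_delta push_basis ?size_tuple // (valP t).
congr (basis _ _ _ _); rewrite -[RHS]map_id; apply: eq_map => v.
by have := vmapE (id_contraction Q) v => -[].
Qed.

Lemma push_comp Q2 Q1 Q0 (f : contraction Q1 Q0) (h : contraction Q2 Q1)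
    (c : MC R Q2 k l) :
  push (comp_contraction f h) c = push f (push h c).
Proof.
apply: (eq_linear_delta (f := @push R _ _ (comp_contraction f h) k l)
  (g := @push R _ _ f k l \o @push R _ _ h k l)) => t /=.
rewrite -basis_delta; set s := val (val t).
have sz : size s = k.+1 by rewrite size_tuple.
have adm : admissible l s := valP t.
rewrite !push_basis // adm push_basis ?size_map //.
have -> : map (vmap (comp_contraction f h)) s = map (vmap f) (map (vmap h) s).
  by rewrite -map_comp; apply: eq_map => v; apply: vmap_comp.
case: ifPn => // admh; rewrite basis0 //; apply: contra admh => /andP[_ /eqP lfh].
have /andP[_ /eqP ls] := adm.
apply: admissible_map => //; apply: le_inf_anti.
  by rewrite -ls length_map.
by rewrite -lfh length_map.
Qed.

Fact MH_map_id Q (x : MH R Q k l) : MH_map (id_contraction Q) x = x.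
Proof.
elim/subquot_ind: x => z; rewrite MH_mapE.
congr (subquot_class _ _); apply: val_inj => /=.
by apply: dualP => c /=; rewrite push_id.
Qed.

Fact MH_map_comp Q2 Q1 Q0 (f : contraction Q1 Q0) (h : contraction Q2 Q1)
    (x : MH R Q0 k l) :
  MH_map (comp_contraction f h) x = MH_map h (MH_map f x).
Proof.
elim/subquot_ind: x => z; rewrite !MH_mapE.
congr (subquot_class _ _); apply: val_inj => /=.
by apply: dualP => c /=; rewrite push_comp.
Qed.

Definition MH_module : cmodule (opposite (CQuiver_category g)) R :=
  @CModule (opposite (CQuiver_category g)) R (fun Q : cquiver g => MH R Q k l)
    (fun (Q Q' : cquiver g) (f : contraction Q' Q) =>
       @MH_map R Q' Q f k l)
    (fun Q : cquiver g => @MH_map_id Q)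
    (fun (Q0 Q1 Q2 : cquiver g) (f : contraction Q2 Q1)
         (h : contraction Q1 Q0) => @MH_map_comp Q2 Q1 Q0 h f).
End MagnitudeFunctor.

(* Main.v *)
From HB Require Import structures.
Require Import Defs.
From mathcomp Require Import all_boot all_order all_algebra.
From mathcomp Require Import boolp classical_sets functions.

Set Implicit Arguments.
Unset Strict Implicit.
Unset Printing Implicit Defensive.
Import GRing.Theory.
Local Open Scope ring_scope.

(* The complex MC_{*,l} splits according to the endpoints (a, b) of the tuples,
   since the differential only deletes interior entries.  The tuples from a to b
   live on the directed walks of length l from a to b.  The rational 1-chains of
   these walks have boundary b - a, so they span a space of dimension at most
   g + 2; as their coefficients are nonnegative, their supports involve only
   boundedly many edges.  The same dimension count shows that, S being the
   vertices of these walks, all but boundedly many edges e can be contracted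
   without creating a new walk of length at most l between vertices of S.  For
   such an e the (a, b)-component of a cocycle is pulled back from a cocycle on
   Q/e.  Hence, when Q has many edges, every cocycle is a sum of pull-backs along
   contractions of single edges (degree l = 0, where S does not control the
   fibres, is elementary), and the module is generated by its values on the
   finitely many isomorphism classes of quivers with few edges; these values are
   finitely generated because R is Noetherian. *)

(** * Submodules over a Noetherian ring *)

Section SubmoduleGeneration.
Variable R : comPzRingType.

Lemma submod_sum (W : lmodType R) (Y : submodule W) (I : finType)
    (P : pred I) (x : I -> W) :
  (forall i, P i -> Y (x i)) -> Y (\sum_(i | P i) x i).
Proof.
by move=> Yx; apply: big_ind => //; [apply: submod0 | apply: submodD].
Qed.

(** Generation is tested against all submodules [Y], the form in which it is combined below with
    subfunctors, rather than by linear combinations. *)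
Definition submod_fg (W : lmodType R) (Z : submodule W) : Prop :=
  exists (I : finType) (x : I -> W), (forall i, Z (x i)) /\
    forall Y : submodule W, (forall i, Y (x i)) -> forall z, Z z -> Y z.

Section Functional.
Variables (W : lmodType R) (Z : submodule W) (p : {linear W -> R^o}).

Definition image_submod : submodule (R^o : lmodType R).
Proof.
apply: (@Submodule _ _ (fun y : R^o => exists2 z, Z z & y = p z)).
- by exists 0; [apply: submod0 | rewrite linear0].
- move=> _ _ [x Zx ->] [y Zy ->].
  by exists (x + y); [apply: submodD | rewrite linearD].
- by move=> a _ [x Zx ->]; exists (a *: x); [apply: submodZ | rewrite linearZ].
Defined.

Definition kernel_submod : submodule W.
Proof.
apply: (@Submodule _ _ (fun z => Z z /\ p z = 0)).
- by split; [apply: submod0 | rewrite linear0].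
- by move=> x y [Zx x0] [Zy y0]; split; [apply: submodD | rewrite linearD x0 y0 addr0].
- by move=> a x [Zx x0]; split; [apply: submodZ | rewrite linearZ /= x0 scaler0].
Defined.

(** The image of [Z] under [p] is an ideal, hence finitely generated. Lifts of its generators,
    together with generators of the kernel, generate [Z]. *)
Lemma submod_fg_extension :
  noetherian R -> submod_fg kernel_submod -> submod_fg Z.
Proof.
move=> Rn [I [x [Kx Kgen]]].
have [n [y yP]] := Rn image_submod.
have yI i : exists2 z, Z z & y i = p z.
  apply/(yP (y i)); exists (fun j => (j == i)%:R).
  rewrite (bigD1 i) //= eqxx mul1r big1 ?addr0 // => j /negPf ->.
  by rewrite mul0r.
have {}yI i : exists z, Z z /\ y i = p z by have [z ? ?] := yI i; exists z.
have [w wP] := choice yI.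
exists (I + 'I_n)%type, (fun s => match s with inl i => x i | inr j => w j end).
split=> [[i|j]|Y YP z Zz]; [by have [] := Kx i | by have [] := wP j |].
have /(yP (p z))[a az] : image_submod (p z) by exists z.
set u := \sum_i a i *: w i.
have Zu : Z u by apply: submod_sum => i _; apply: submodZ; have [] := wP i.
have Yu : Y u by apply: submod_sum => i _; apply/submodZ/(YP (inr i)).
(* [u] is a combination of the lifts with the same image as [z], so [z - u] lies in the kernel. *)
rewrite -(subrK u z); apply: submodD => //.
apply: Kgen => [i|]; first exact: YP (inl i).
split; first by apply: submodD => //; rewrite -scaleN1r; apply: submodZ.
rewrite linearB /= az linear_sum /=; apply/eqP; rewrite subr_eq0; apply/eqP.
by apply: eq_bigr => i _; rewrite linearZ /=; have [_ ->] := wP i.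
Qed.
End Functional.

(** The functionals embed [Z] into a finite free module. The induction splits off one functional at
    a time and passes to its kernel. *)
Lemma submod_fg_functionals (W : lmodType R) (ps : seq {linear W -> R^o}) :
  noetherian R -> forall Z : submodule W,
  (forall z, Z z ->
    (forall i, (i < size ps)%N -> nth (\0 : {linear W -> R^o}) ps i z = 0) ->
    z = 0) ->
  submod_fg Z.
Proof.
move=> Rn; elim: ps => [|p ps IHps] Z Zinj.
  exists 'I_0, (fun=> 0); split=> [[]//|Y _ z Zz].
  by rewrite (Zinj z) //; apply: submod0.
apply: (submod_fg_extension (p := p)) => //.
apply: IHps => z [Zz pz] psz; apply: Zinj => // -[|i] //=; exact: psz.
Qed.

Section Evaluation.
Variables (U : lmodType R) (u : U).
Definition dual_eval (h : dual U) : R^o := h u.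
Fact dual_eval_is_linear : linear dual_eval.
Proof. by []. Qed.
HB.instance Definition _ :=
  GRing.isLinear.Build R (dual U) R^o *:%R dual_eval dual_eval_is_linear.
End Evaluation.

Lemma dual_ffun_eq (X : finType) (h h' : dual {ffun X -> R^o}) :
  (forall x, h (delta R x) = h' (delta R x)) -> h = h'.
Proof. by move=> hh; apply/dualP/eq_linear_delta. Qed.

Lemma submod_fg_dual (X : finType) (Z : submodule (dual {ffun X -> R^o})) :
  noetherian R -> submod_fg Z.
Proof.
move=> Rn; pose ev x : {linear dual {ffun X -> R^o} -> R^o} :=
  dual_eval (delta R x).
apply: (submod_fg_functionals (ps := [seq ev x | x <- enum X])) => // z _ z0.
apply: dual_ffun_eq => x; have := z0 (index x (enum X)).
rewrite size_map index_mem mem_enum (nth_map x) ?index_mem ?mem_enum //.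
by rewrite nth_index ?mem_enum // => /(_ isT).
Qed.
End SubmoduleGeneration.

(** * Finite generation from finitely many objects *)

Section GenerationCriterion.
Variables (C : category) (R : comPzRingType) (M : cmodule C R).

(** Equality of objects is decided classically, and [x] is transported along it. *)
Definition concentrated_val (c : C) (x : M c) (d : C) : M d :=
  if pselect (c = d) is left E then eq_rect c (fun c => M c : Type) x d E else 0.

Fact concentrated_finite (c : C) (x : M c) : exists (n : nat) (s : 'I_n -> C),
  forall d, concentrated_val x d <> 0 -> exists i, s i = d.
Proof.
exists 1%N, (fun=> c) => d; rewrite /concentrated_val.
by case: pselect => // E _; exists ord0.
Qed.

Definition concentrated (c : C) (x : M c) : direct_sum M :=
  DirectSum (concentrated_finite x).

Lemma concentrated_at (c : C) (x : M c) : concentrated x c = x.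
Proof.
rewrite /= /concentrated_val; case: pselect => // E.
by rewrite (Prop_irrelevance E erefl).
Qed.

Definition full_submod (W : lmodType R) : submodule W :=
  @Submodule R W (fun=> True) I (fun _ _ _ _ => I) (fun _ _ _ => I).

(** The generators of the modules at the objects [s t], each placed in its own summand, form the
    finite family: a subfunctor containing them is full at every [s t]. *)
Lemma finitely_generated_criterion (T : finType) (s : T -> C) :
  (forall t, submod_fg (full_submod (M (s t)))) ->
  (forall N : subfunctor M, (forall t y, N (s t) y) -> forall c y, N c y) ->
  finitely_generated M.
Proof.
move=> fgs gen.
pose J t := projT1 (cid (fgs t)); pose x t := projT1 (cid (projT2 (cid (fgs t)))).
have xP t (Y : submodule (M (s t))) : (forall i, Y (x t i)) -> forall y, Y y.
  have [_ wP] := projT2 (cid (projT2 (cid (fgs t)))).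
  by move=> Yx y; apply: wP.
pose K : finType := {t : T & J t}.
exists #|K|, (fun i => let j : K := enum_val i in concentrated (x (tag j) (tagged j))).
move=> c y N NS; apply: gen => t; apply: xP => i.
have {}NS := NS _ (ex_intro _ (enum_rank (Tagged J i)) erefl) (s t).
by rewrite enum_rankK concentrated_at in NS.
Qed.
End GenerationCriterion.

(** * Bounds from rational chains *)

Section SupportBound.
Variable E : finType.
Implicit Types (c : {ffun E -> rat^o}) (U : {vspace {ffun E -> rat^o}}).

Definition chain_support c : {set E} := [set e | c e != 0].

Definition erase (D : {set E}) c : {ffun E -> rat^o} :=
  [ffun e => if e \in D then 0 else c e].

Fact erase_is_linear D : linear (erase D).
Proof.
move=> a b c; apply/ffunP=> e; rewrite !ffunE.
by case: ifP => _; rewrite ?scaler0 ?addr0.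
Qed.
HB.instance Definition _ D := GRing.isLinear.Build rat {ffun E -> rat^o}
  {ffun E -> rat^o} *:%R (erase D) (erase_is_linear D).

(** Induction on the dimension of [U]: erasing the support of one vector [c0] of [U] loses at most
    [m] elements of [B], and lowers the dimension because [c0] is killed. The remaining elements
    satisfy the hypothesis for the image of [U]. *)
Lemma support_bound (m : nat) U (B : {set E}) :
  (forall e, e \in B -> exists c,
    [/\ c \in U, c e != 0 & (#|chain_support c| <= m)%N]) ->
  (#|B| <= m * \dim U)%N.
Proof.
have [n] := ubnP (\dim U); elim: n => // n IHn in U B *.
rewrite ltnS => dU BU.
have [->|/set0Pn[e0 /BU[c0 [cU c0e c0m]]]] := eqVneq B finset.set0.
  by rewrite cards0.
set D := chain_support c0; pose f := linfun (erase D).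
have dimf := limg_ker_dim f U.
have ker_pos : (0 < \dim (U :&: lker f))%N.
  rewrite lt0n dimv_eq0; apply/eqP => /vspaceP/(_ c0).
  rewrite memv_cap cU memv_ker lfunE memv0 /=.
  have -> : erase D c0 == 0.
    by apply/eqP/ffunP=> e; rewrite !ffunE inE; case: eqP.
  by move/esym/eqP => c00; rewrite c00 ffunE eqxx in c0e.
have dfU : (\dim (f @: U) < \dim U)%N by rewrite -dimf -addn1 addnC leq_add2r.
have {}IHn := IHn (f @: U)%VS (B :\: D) (leq_trans dfU dU).
apply: leq_trans (_ : (m + m * \dim (f @: U)) <= _)%N; last first.
  by rewrite -mulnS leq_mul2l dfU orbT.
rewrite -(cardsID D B) leq_add //.
  by apply: leq_trans c0m; apply/subset_leq_card/subsetIr.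
apply: IHn => e; rewrite inE => /andP[eD /BU[c [cU' ce cm]]].
exists (erase D c); split.
- by rewrite -[erase D c](lfunE (erase D)); apply: memv_img.
- by rewrite ffunE (negPf eD).
- apply: leq_trans cm; apply/subset_leq_card/fintype.subsetP => e'.
  by rewrite !inE ffunE; case: ifP; rewrite ?eqxx.
Qed.
End SupportBound.

(** * Relative cycles, walks and bad edges *)

Section RelativeChains.
Variable Q : quiver.
Implicit Types (u v w : vertex Q) (p : seq (edge Q)) (S : {set vertex Q}).

Definition rel_boundary S (c : {ffun edge Q -> rat^o}) : {ffun vertex Q -> rat^o} :=
  erase S (boundary c).
Fact rel_boundary_is_linear S : linear (rel_boundary S).
Proof. by move=> a b c; rewrite /rel_boundary !linearP. Qed.
HB.instance Definition _ S := GRing.isLinear.Build rat {ffun edge Q -> rat^o}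
  {ffun vertex Q -> rat^o} *:%R (rel_boundary S) (rel_boundary_is_linear S).

(** These are the rational 1-cycles of the realization relative to the set [S] of 0-cells. *)
Definition rel_cycles S : {vspace {ffun edge Q -> rat^o}} :=
  lker (linfun (rel_boundary S)).

Lemma rel_cyclesP S c :
  reflect (forall v, v \notin S -> boundary c v = 0) (c \in rel_cycles S).
Proof.
rewrite memv_ker lfunE; apply: (iffP eqP) => [/ffunP h v vS|h].
  by have := h v; rewrite !(ffunE, inE) (negPf vS).
apply/ffunP=> v; rewrite /= /rel_boundary ffunE [RHS]ffunE.
by case: ifPn => // vS; apply: h.
Qed.

(** The boundary map sends relative cycles to chains supported on [S], and its kernel consists of
    cycles, which contribute at most the genus. *)
Lemma dim_rel_cycles S : (\dim (rel_cycles S) <= genus Q + #|S|)%N.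
Proof.
rewrite -(limg_ker_dim (linfun (@boundary Q)) (rel_cycles S)) leq_add //.
  exact/dimvS/capvSr.
pose d v : {ffun vertex Q -> rat^o} := [ffun w => (w == v)%:R].
rewrite cardE -(size_map d); apply: leq_trans (dim_span _).
apply/dimvS/subvP=> _ /memv_imgP[c /rel_cyclesP cS ->]; rewrite lfunE /=.
have dE (a : rat) w v : (a *: d w) v = a * (v == w)%:R by rewrite !ffunE.
have -> : boundary c = \sum_(v in S) boundary c v *: d v.
  apply/ffunP=> v; rewrite sum_ffunE.
  under eq_bigr do rewrite dE.
  have [vS|vS] := boolP (v \in S).
    rewrite (bigD1 v) //= eqxx big1 ?addr0 => [|w /andP[_ wv]].
      by rewrite mulr1.
    by rewrite eq_sym (negPf wv) mulr0.
  rewrite (cS v vS) big1 // => w wS; case: eqP => [vw|_]; last by rewrite mulr0.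
  by rewrite vw wS in vS.
apply: memv_suml => v vS; apply/memvZ/memv_span.
by apply: map_f; rewrite mem_enum.
Qed.

Lemma rel_cycles_support_bound S m (B : {set edge Q}) :
  (forall e, e \in B -> exists c,
    [/\ c \in rel_cycles S, c e != 0 & (#|chain_support c| <= m)%N]) ->
  (#|B| <= m * (genus Q + #|S|))%N.
Proof.
move=> /support_bound h; apply: leq_trans h _.
by rewrite leq_mul2l dim_rel_cycles orbT.
Qed.

Definition walk_chain p : {ffun edge Q -> rat^o} :=
  \sum_(e <- p) [ffun e' => (e' == e)%:R].

Lemma boundary_edge e v :
  boundary [ffun e' => (e' == e)%:R] v = (tgt e == v)%:R - (src e == v)%:R.
Proof.
rewrite ffunE (bigD1 e) //= ffunE eqxx mul1r big1 ?addr0 // => e' /negPf e'e.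
by rewrite ffunE e'e mul0r.
Qed.

Lemma boundary_walk u p w v : directed_path u p w ->
  boundary (walk_chain p) v = (w == v)%:R - (u == v)%:R.
Proof.
rewrite /walk_chain; elim: p u => [|e p IHp] u /=.
  by move=> /eqP ->; rewrite big_nil linear0 ffunE subrr.
move=> /andP[/eqP <- /IHp bp]; rewrite big_cons linearD /= ffunE bp boundary_edge.
by rewrite addrC addrA subrK.
Qed.

Lemma walk_chainE p e : walk_chain p e = (count_mem e p)%:R.
Proof.
rewrite /walk_chain sum_ffunE -sum1_count natr_sum [RHS]big_mkcond.
by apply: eq_bigr => e' _; rewrite ffunE eq_sym /=; case: eqP.
Qed.

Lemma walk_support p : (#|chain_support (walk_chain p)| <= size p)%N.
Proof.
apply: leq_trans (card_size p); apply/subset_leq_card/fintype.subsetP => e.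
by rewrite inE walk_chainE -has_pred1 has_count; case: count.
Qed.

Definition walk_edge (a b : vertex Q) (l : nat) : pred (edge Q) := fun e =>
  [exists p : l.-tuple (edge Q), directed_path a p b && (e \in tval p)].

(* Walk chains have nonnegative coefficients, so no edge of a walk cancels. *)
Lemma walk_edge_bound a b l :
  (#|[set e | walk_edge a b l e]| <= l * (genus Q + 2))%N.
Proof.
apply: leq_trans (rel_cycles_support_bound (S := [set a; b]) (m := l) _) _.
  move=> e; rewrite inE => /existsP[p /andP[ab ep]].
  exists (walk_chain p); split.
  - apply/rel_cyclesP => v; rewrite !inE negb_or => /andP[va vb].
    by rewrite (boundary_walk v ab) 2!(eq_sym _ v) (negPf va) (negPf vb) subrr.
  - by rewrite walk_chainE Num.Theory.pnatr_eq0 -lt0n -has_count has_pred1.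
  - by rewrite -[X in (_ <= X)%N](size_tuple p) walk_support.
by rewrite leq_mul2l leq_add2l cards2 ltnS leq_b1 orbT.
Qed.

(** Every vertex of a walk after the first is the target of one of its edges, so the initial vertex
    and the targets suffice. *)
Definition walk_vertices a b l : {set vertex Q} :=
  a |: [set tgt e | e in walk_edge a b l].

Lemma card_walk_vertices a b l :
  (#|walk_vertices a b l| <= (l * (genus Q + 2)).+1)%N.
Proof.
apply: leq_trans (_ : _ <= 1 + #|walk_edge a b l|)%N _.
  apply: leq_trans (leq_card_setU _ _) _; rewrite cards1 leq_add2l.
  exact: leq_imset_card.
rewrite add1n ltnS -cardsE; exact: walk_edge_bound.
Qed.

(* The two path conditions say that the edges of [p1 ++ p2] become a walk from
   [u] to [v] once the endpoints of [e] are identified, but are none before. *)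
Definition bad_edge S l (e : edge Q) : Prop :=
  src e = tgt e \/ exists u v z z' p1 p2,
    [/\ (u \in S) && (v \in S), (e \notin p1) && (e \notin p2),
        directed_path u p1 z /\ directed_path z' p2 v,
        (z, z') = (src e, tgt e) \/ (z, z') = (tgt e, src e) &
        (size p1 + size p2 <= l)%N].

(** A bad edge lies in the support of a small relative cycle: a loop is itself a cycle, and
    otherwise the two walks are joined by [e], suitably oriented. As [e] is on neither walk, its
    coefficient does not cancel. *)
Lemma bad_edge_bound S l (B : {set edge Q}) :
  (forall e, e \in B -> bad_edge S l e) ->
  (#|B| <= l.+1 * (genus Q + #|S|))%N.
Proof.
move=> Bbad; apply: rel_cycles_support_bound => e /Bbad[eloop|].
  exists (walk_chain [:: e]); split.
  - by apply/rel_cyclesP => v _; rewrite /walk_chain big_seq1 boundary_edge eloop subrr.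
  - by rewrite walk_chainE /= eqxx.
  - exact: leq_trans (walk_support _) _.
move=> [u [v [z [z' [p1 [p2 [/andP[uS vS] /andP[ep1 ep2] [up pv] zz' sz]]]]]]].
have n0 p : e \notin p -> walk_chain p e = 0.
  by move=> ep; rewrite walk_chainE (count_memPn ep).
(* The sign orients [e] from [z] to [z']. *)
pose s : rat := if z == src e then 1 else -1.
have zz's w : (z' == w)%:R - (z == w)%:R = s * ((tgt e == w)%:R - (src e == w)%:R).
  rewrite /s; case: zz' => -[-> ->]; first by rewrite eqxx mul1r.
  by case: (eqVneq (tgt e) (src e)) => [->|_]; rewrite ?subrr ?mulr0 // mulN1r opprB.
have s0 : s != 0 by rewrite /s; case: ifP.
exists (walk_chain p1 + walk_chain p2 + s *: walk_chain [:: e]); split.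
- apply/rel_cyclesP => w wS.
  have addE (c1 c2 c3 : {ffun vertex Q -> rat^o}) :
    (c1 + c2 + s *: c3) w = c1 w + c2 w + s * c3 w by rewrite !ffunE.
  rewrite !linearD linearZ /= addE (boundary_walk w up) (boundary_walk w pv).
  rewrite {1}/walk_chain big_seq1 boundary_edge.
  have -> : (u == w) = false by apply: contraNF wS => /eqP <-.
  have -> : (v == w) = false by apply: contraNF wS => /eqP <-.
  by rewrite -zz's subr0 sub0r addrC -addrA addKr addrN.
- by rewrite !ffunE n0 // n0 // !add0r walk_chainE /= eqxx [X in X != _]mulr1.
- apply: leq_trans (_ : #|[set e' in e :: p1 ++ p2]| <= _)%N.
    apply/subset_leq_card/fintype.subsetP => e'.
    rewrite !inE mem_cat !ffunE !walk_chainE /=; apply: contraR.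
    rewrite !negb_or => /andP[e'e /andP[/count_memPn -> /count_memPn ->]].
    by rewrite (eq_sym e) (negPf e'e) !add0r scaler0.
  rewrite cardsE; apply: leq_trans (card_size _) _.
  by rewrite /= ltnS size_cat.
Qed.
End RelativeChains.

(** * Contraction of a single edge *)

Lemma genus_le (Q Q' : quiver)
    (phi : {linear {ffun edge Q -> rat^o} -> {ffun edge Q' -> rat^o}}) :
  injective phi -> (forall c, boundary c = 0 -> boundary (phi c) = 0) ->
  (genus Q <= genus Q')%N.
Proof.
move=> phi_inj phi_cycle.
rewrite /genus -(@limg_dim_eq _ _ _ (linfun phi)).
  apply/dimvS/subvP=> _ /memv_imgP[c cQ ->]; rewrite lfunE.
  by rewrite memv_ker lfunE; apply/eqP/phi_cycle; apply/eqP; rewrite memv_ker lfunE in cQ.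
apply/eqP; rewrite -subv0; apply/subvP=> c; rewrite memv_cap => /andP[_].
by rewrite memv_ker lfunE memv0 -(inj_eq phi_inj) linear0.
Qed.

Lemma contraction_connected (Q' Q : quiver) (f : contraction Q' Q) :
  connected Q' -> connected Q.
Proof.
move=> /andP[/card_gt0P[v0 _] /'forall_forallP cn]; apply/andP; split.
  by apply/card_gt0P; exists (vmap f v0).
apply/'forall_forallP => x y.
have [x' <-] := vmap_surj f x; have [y' <-] := vmap_surj f y.
have /connectP[p + ->] := cn x' y'.
elim: p x' => [|z p IHp] x' //= /andP[/existsP[e xz] /IHp].
apply: connect_trans; case fe: (f (inr e)) => [u|e1].
  by have [s t] := edge_contracted fe; case/orP: xz => /andP[/eqP <- /eqP <-]; rewrite s t.
have [s t] := edge_kept fe; apply: connect1; apply/existsP; exists e1.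
by case/orP: xz => /andP[/eqP <- /eqP <-]; rewrite s t !eqxx ?orbT.
Qed.

Section EdgeContraction.
Variables (Q : quiver) (e0 : edge Q).
Hypothesis nonloop : src e0 != tgt e0.
Let x := src e0.
Let y := tgt e0.

(** The vertex obtained by merging [x] and [y] is represented by [x], and [y] is removed. *)
Definition ct_vertex := {v : vertex Q | v != y}.
Definition ct_edge := {e : edge Q | e != e0}.

Fact ct_proj_subproof v : (if v == y then x else v) != y.
Proof. by case: ifPn. Qed.
Definition ct_proj v : ct_vertex := Sub (if v == y then x else v) (ct_proj_subproof v).

Definition contracted : quiver :=
  @Quiver ct_vertex ct_edge (fun e => ct_proj (src (val e)))
    (fun e => ct_proj (tgt (val e))).

Definition ct_cell (c : cell Q) : cell contracted :=
  match c with
  | inl v => inl (ct_proj v)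
  | inr e => if insub e is Some e' then inr (e' : ct_edge) else inl (ct_proj x)
  end.

Lemma ct_projK (v : ct_vertex) : ct_proj (val v) = v.
Proof. by apply: val_inj; rewrite /= (negPf (valP v)). Qed.

Lemma ct_proj_xy : ct_proj x = ct_proj y.
Proof. by apply: val_inj; rewrite /= eqxx (negPf nonloop). Qed.

Lemma ct_proj_eq v w : ct_proj v = ct_proj w ->
  [\/ v = w, v = x /\ w = y | v = y /\ w = x].
Proof.
move/(congr1 val) => /=; case: (eqVneq v y) => [->|_]; case: (eqVneq w y) => [->|_].
- by constructor 1.
- by move=> <-; constructor 3.
- by move=> ->; constructor 2.
- by constructor 1.
Qed.

Lemma ct_cell_e0 : ct_cell (inr e0) = inl (ct_proj x).
Proof. by rewrite /= insubN ?negbK. Qed.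

Lemma ct_cell_edge (e : ct_edge) : ct_cell (inr (val e)) = inr e.
Proof. by rewrite /= valK. Qed.

Lemma ct_cell_inr e c : ct_cell (inr e) = c ->
  (e = e0 /\ c = inl (ct_proj x)) \/ (exists2 e' : ct_edge, e = val e' & c = inr e').
Proof.
case: (eqVneq e e0) => [->|ee0]; first by rewrite ct_cell_e0 => <-; left.
pose e' : ct_edge := Sub e ee0.
have -> : e = val e' by [].
by rewrite ct_cell_edge => <-; right; exists e'.
Qed.

Fact ct_vertexP : (ct_cell @` range inl = range inl)%classic.
Proof.
apply/seteqP; split=> [_ [_ [v _ <-] <-]|_ [v _ <-]]; first by exists (ct_proj v).
by exists (inl (val v)); [exists (val v) | rewrite /= ct_projK].
Qed.

Fact ct_edgeP : edge_compatible ct_cell.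
Proof.
move=> e; case: (ct_cell_inr (erefl (ct_cell (inr e)))) => [[-> ->]|[e' -> ->]] //=.
by split=> //; rewrite -/x -/y ct_proj_xy.
Qed.

Fact ct_bijP : set_bij (ct_cell @^-1` range inr)%classic (range inr) ct_cell.
Proof.
have inv c e' : ct_cell c = inr e' -> c = inr (val e').
  case: c => [//|e] /ct_cell_inr[[_ ]//|[e'' -> [->]]] //.
split=> [c //|c c'|_ [e' _ <-]].
  rewrite !inE /= => -[e _ /esym ce] [e' _ /esym ce']; rewrite ce ce' => -[ee'].
  by rewrite (inv _ _ ce) (inv _ _ ce') ee'.
by exists (inr (val e')); rewrite /= valK //; exists e'.
Qed.

Fact ct_fiberP v : directed_tree (fiber ct_edgeP v).
Proof.
apply/andP; split.
  apply/fiber_connectedP; split=> [|u w [uv] [wv]].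
    by exists (val v); rewrite /= ct_projK.
  have : ct_proj u = ct_proj w by rewrite uv.
  have e0v : (ct_proj x = v) -> ct_cell (inr e0) == inl v.
    by move=> <-; rewrite ct_cell_e0.
  case/ct_proj_eq => [->//|[ux wy]|[uy wx]]; apply/connect1/existsP; exists e0.
    by rewrite e0v -?ux // /x /y ux wy !eqxx.
  by rewrite e0v -?wx // /x /y uy wx !eqxx orbT.
(* A chain on the fiber is supported on [e0], and its boundary at [y] is its coefficient there. *)
apply/fiber_acyclicP => c cv /ffunP/(_ y); rewrite !ffunE.
have c0 e : e != e0 -> c e = 0.
  move=> ee0; apply/eqP; apply: contraT => /cv.
  by rewrite -[e]/(val (Sub e ee0 : ct_edge)) ct_cell_edge.
rewrite (bigD1 e0) //= big1 ?addr0 => [|e ee0]; last by rewrite c0 ?mul0r.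
rewrite eqxx (negPf nonloop) subr0 mulr1 => ce0.
by apply/ffunP=> e; rewrite ffunE; case: (eqVneq e e0) => [->//|/c0].
Qed.

Definition edge_contraction : contraction Q contracted :=
  Contraction ct_vertexP ct_bijP ct_fiberP.

Lemma vmap_ct v : vmap edge_contraction v = ct_proj v.
Proof. by have := vmapE edge_contraction v => -[]. Qed.

Let inc (e : edge Q) (v : vertex Q) : rat := (tgt e == v)%:R - (src e == v)%:R.

(** This is the boundary at [v] in [Q] of [c] extended by 0 to [e0]. *)
Definition ct_flux (c : {ffun ct_edge -> rat^o}) (v : vertex Q) : rat :=
  \sum_e c e * inc (val e) v.

(** The coefficient at [e0] is chosen to cancel the boundary at [y]. *)
Definition ct_lift (c : {ffun ct_edge -> rat^o}) : {ffun edge Q -> rat^o} :=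
  [ffun e => if insub e is Some e' then c e' else - ct_flux c y].

Fact ct_lift_is_linear : linear ct_lift.
Proof.
move=> a b c; apply/ffunP=> e; rewrite !ffunE; case: insub => [e'|]; rewrite ?ffunE //.
rewrite /ct_flux scalerN -opprD; congr (- _); rewrite scaler_sumr -big_split /=.
by apply: eq_bigr => e' _; rewrite !ffunE mulrDl -mulrA.
Qed.
HB.instance Definition _ := GRing.isLinear.Build rat {ffun ct_edge -> rat^o}
  {ffun edge Q -> rat^o} *:%R ct_lift ct_lift_is_linear.

Lemma ct_lift_inj : injective ct_lift.
Proof.
move=> b c /ffunP bc; apply/ffunP=> e; have := bc (val e).
by rewrite !ffunE valK.
Qed.

Lemma boundary_ct_lift c v :
  boundary (ct_lift c) v = ct_flux c v - ct_flux c y * inc e0 v.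
Proof.
rewrite ffunE (bigD1 e0) //= ffunE insubN ?negbK // addrC mulNr; congr (_ - _).
rewrite (reindex_omap val (insub : edge Q -> option ct_edge)) /=; last first.
  by move=> e ee0; rewrite insubT.
by apply: eq_big => [e|e _]; rewrite ?(valP e) ?valK ?eqxx // ffunE valK.
Qed.

Lemma boundary_contracted (c : {ffun edge contracted -> rat^o}) (v : vertex contracted) :
  boundary c v = ct_flux c (val v) + (if val v == x then ct_flux c y else 0).
Proof.
have projE u : (ct_proj u == v)%:R =
    (u == val v)%:R + (if val v == x then (u == y)%:R else 0) :> rat.
  rewrite -val_eqE /=; have vy := valP v.
  case: (eqVneq u y) => [->|uy]; last by case: ifP; rewrite addr0.
  by rewrite (eq_sym y) (negPf vy) (eq_sym x) add0r; case: eqP.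
rewrite ffunE; under eq_bigr do rewrite /= !projE.
case: ifP => _; last by rewrite addr0; apply: eq_bigr => e _; rewrite !addr0.
by rewrite -big_split; apply: eq_bigr => e _ /=; rewrite -mulrDr addrACA -opprD.
Qed.

(** [ct_lift] maps cycles to cycles: the boundary vanishes at [y] by the choice of the coefficient
    at [e0], and at every other vertex it agrees with the boundary in the contracted quiver. *)
Lemma genus_contracted : (genus contracted <= genus Q)%N.
Proof.
apply: (@genus_le contracted Q ct_lift) => [|c c0]; first exact: ct_lift_inj.
apply/ffunP=> v.
rewrite boundary_ct_lift [RHS]ffunE /inc -/x -/y.
case: (eqVneq v y) => [->|vy].
  by rewrite (negPf nonloop) subr0 mulr1 subrr.
have := boundary_contracted c (Sub v vy); rewrite c0 ffunE /= => /esym.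
rewrite (eq_sym x) sub0r mulrN opprK.
by case: eqP; rewrite ?mulr1 ?mulr0.
Qed.

Lemma card_contracted_edge : (#|edge contracted| < #|edge Q|)%N.
Proof.
rewrite card_sig; apply: (@leq_trans #|edge Q|.-1.+1).
  by rewrite ltnS -(cardC1 e0).
by rewrite prednK //; apply/card_gt0P; exists e0.
Qed.

Lemma ct_path u p w : directed_path u p w -> e0 \notin p ->
  exists2 q : seq (edge contracted), map val q = p &
    directed_path (ct_proj u : vertex contracted) q (ct_proj w).
Proof.
elim: p u => [|e p IHp] u /=; first by move=> /eqP -> _; exists [::] => /=.
rewrite inE negb_or (eq_sym e0) => /andP[/eqP <- pw] /andP[ee0 /(IHp _ pw)[q <- qw]].
by exists ((Sub e ee0 : ct_edge) :: q); rewrite /= ?eqxx.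
Qed.

(** An occurrence of [e0] in a walk collapses to a vertex, while no other edge gets longer. *)
Lemma ct_dist_lt u p w : directed_path u p w -> e0 \in p ->
  exists2 m, (m < size p)%N & le_inf (dist (ct_proj u : vertex contracted) (ct_proj w)) (Some m).
Proof.
move=> up e0p; have [m mp] : exists2 m, (m < size p)%N &
    reach m (ct_proj u : vertex contracted) (ct_proj w).
  elim: p u up e0p => [//|e p IHp] u /= /andP[/eqP <- pw].
  have pw' : exists2 m, (m <= size p)%N & reach m (ct_proj (tgt e) : vertex contracted) (ct_proj w).
    have := dist_map edge_contraction (tgt e) w; rewrite !vmap_ct => h1.
    apply: (dist_leP _ _ _).1; apply: le_inf_trans h1 _; apply/dist_leP.
    by exists (size p) => //; apply/reachP; exists p.
  rewrite inE; case: (eqVneq e0 e) => [ee _|ee0 /= /(IHp _ pw)[m mp /reachP[q sq qw]]].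
    by rewrite -ee -/x ct_proj_xy /y ee.
  exists m.+1 => //; apply/reachP; rewrite eq_sym in ee0.
  by exists ((Sub e ee0 : ct_edge) :: q); rewrite /= ?sq ?eqxx.
by move=> r; exists m => //; apply/dist_leP; exists m.
Qed.
End EdgeContraction.

Definition ccontracted g (Q : cquiver g) (e0 : edge Q) (nl : src e0 != tgt e0) : cquiver g :=
  CQuiver (contraction_connected (edge_contraction nl) (cquiver_connected Q))
    (leq_trans (genus_contracted nl) (cquiver_genus Q)).

(** * Lifting geodesics *)

Section WalkDistance.
Variable Q : quiver.
Implicit Types (u v w : vertex Q) (p : seq (edge Q)).

Lemma dist_le_path u p v :
  directed_path u p v -> le_inf (dist u v) (Some (size p)).
Proof. by move=> up; apply/dist_leP; exists (size p) => //; apply/reachP; exists p. Qed.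

Lemma dist_geodesic u v m : dist u v = Some m ->
  exists2 p, size p = m & directed_path u p v.
Proof. by move=> /dist_reach/reachP. Qed.

Lemma geodesic_tail u e p v : directed_path u (e :: p) v ->
  dist u v = Some (size p).+1 -> dist (tgt e) v = Some (size p).
Proof.
move=> /andP[/eqP ue pv] duv; apply: le_inf_anti; first exact: dist_le_path.
case dv: (dist (tgt e) v) => [m|] //.
have [p' <- pv'] := dist_geodesic dv.
have : directed_path u (e :: p') v by rewrite /= ue eqxx.
by move=> /dist_le_path; rewrite duv.
Qed.

Lemma directed_path_end u p v w :
  directed_path u p v -> directed_path u p w -> v = w.
Proof.
elim: p u => [|e p IHp] u /=; first by move=> /eqP <- /eqP.
by move=> /andP[_ pv] /andP[_]; apply: IHp.
Qed.

Lemma directed_path_split u p q v : directed_path u (p ++ q) v ->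
  exists2 w, directed_path u p w & directed_path w q v.
Proof.
elim: p u => [|e p IHp] u /=; first by exists u.
by move=> /andP[-> /IHp].
Qed.

Lemma add_inf_le a b n : le_inf (add_inf a b) (Some n) ->
  le_inf a (Some n) /\ le_inf b (Some n).
Proof.
case: a b => [a|] [b|] //= abn.
by split; apply: leq_trans abn; rewrite ?leq_addr ?leq_addl.
Qed.

(** Termwise inequalities whose sums agree are equalities. The bound by [n] ensures that the sums
    are finite. *)
Lemma add_inf_eq a b a' b' n : le_inf a a' -> le_inf b b' ->
  add_inf a' b' = add_inf a b -> le_inf (add_inf a b) (Some n) ->
  a' = a /\ b' = b.
Proof.
case: a a' b b' => [a|] [a'|] [b|] [b'|] //= aa bb [ab] _.
have a'a : (a' <= a)%N by rewrite -(leq_add2r b) -ab leq_add2l.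
have b'b : (b' <= b)%N by rewrite -(leq_add2l a) -ab leq_add2r.
by split; congr Some; apply/eqP; rewrite eqn_leq ?aa ?bb ?a'a ?b'b.
Qed.

(** The walk concatenates geodesics between consecutive entries. The description of the entries
    matches the form of [walk_vertices]. *)
Lemma tuple_walk (a : vertex Q) s l : tuple_length (a :: s) = Some l ->
  exists p, [/\ size p = l, directed_path a p (last a s) &
    forall v, v \in a :: s -> v = a \/ exists2 e, e \in p & v = tgt e].
Proof.
elim: s a l => [|b s IHs] a l.
  move=> [<-]; exists [::]; split=> [//|/=|v]; first exact: eqxx.
  by rewrite inE => /eqP; left.
rewrite tuple_length_cons; case dab: (dist a b) => [m|] //.
case lbs: (tuple_length (b :: s)) => [n|] // [<-].
have [p1 <- ab] := dist_geodesic dab; have [p2 [<- bs bsP]] := IHs _ _ lbs.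
exists (p1 ++ p2); split; rewrite ?size_cat //=.
  exact: directed_path_cat ab bs.
have bP : b = a \/ exists2 e, e \in p1 ++ p2 & b = tgt e.
  case/lastP: p1 ab {dab} => [/eqP ->|p1 e]; first by left.
  rewrite -cats1 => /directed_path_split[w _ /= /andP[_ /eqP eb]].
  by right; exists e; rewrite // !mem_cat mem_head orbT.
move=> v; rewrite inE => /orP[/eqP ->|/bsP[->|[e ep ->]]] //; first by left.
by right; exists e; rewrite // mem_cat ep orbT.
Qed.

Lemma walk_vertices_tuple (a : vertex Q) s l : tuple_length (a :: s) = Some l ->
  all (mem (walk_vertices a (last a s) l)) (a :: s).
Proof.
move=> /tuple_walk[p [/eqP sp ap spP]]; apply/allP => v /spP[->|[e ep ->]].
  by rewrite !inE eqxx.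
rewrite !inE; apply/orP; right; apply/imsetP; exists e => //.
by apply/existsP; exists (Tuple sp); rewrite ap.
Qed.
End WalkDistance.

Lemma cons_inj (T : Type) (x y : T) s t : x :: s = y :: t -> x = y /\ s = t.
Proof. by case. Qed.

Section GoodEdge.
Variables (Q : quiver) (e0 : edge Q).
Hypothesis nonloop : src e0 != tgt e0.
Variables (S : {set vertex Q}) (l : nat).
Hypothesis good : ~ bad_edge S l e0.
Local Notation Qc := (contracted nonloop).
Let pi (v : vertex Q) : vertex Qc := ct_proj nonloop v.

Lemma ct_dist_le u v : le_inf (dist (pi u) (pi v)) (dist u v).
Proof. by have := dist_map (edge_contraction nonloop) u v; rewrite !vmap_ct. Qed.

Lemma ct_length_le s : le_inf (tuple_length (map pi s)) (tuple_length s).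
Proof.
have := length_map (edge_contraction nonloop) s.
by rewrite (eq_map (vmap_ct nonloop)).
Qed.

Lemma ct_proj_neq v w : pi v = pi w -> v != w -> pi v = pi (src e0).
Proof.
by move=> /ct_proj_eq[->|[-> _]|[-> _]]; rewrite ?eqxx // /pi ct_proj_xy.
Qed.

Lemma e0_notin_val (q : seq (edge Qc)) : e0 \notin map val q.
Proof. by apply/mapP => -[e _ e0e]; have := valP e; rewrite -e0e eqxx. Qed.

(** If [z] and [z'] differed they would be the two endpoints of [e0], and the two paths would
    witness that [e0] is bad. *)
Lemma good_glue u v z z' p1 p2 : u \in S -> v \in S ->
  e0 \notin p1 ++ p2 -> directed_path u p1 z -> directed_path z' p2 v ->
  pi z = pi z' -> (size (p1 ++ p2) <= l)%N -> z = z'.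
Proof.
rewrite mem_cat negb_or size_cat => uS vS e0p up pv /ct_proj_eq zz sz.
case: zz => // zz; case: good; right; exists u, v, z, z', p1, p2.
  by split; rewrite ?uS //; left; case: zz => -> ->.
by split; rewrite ?uS //; right; case: zz => -> ->.
Qed.

(** The edges of a geodesic lift uniquely, but consecutive lifts may fail to meet where the geodesic
    passes through the merged vertex. A geodesic passes through it at most once, so there is at most
    one break. *)
Lemma geodesic_lift_upto u v (q : seq (edge Qc)) :
  directed_path (pi u) q (pi v) -> dist (pi u) (pi v) = Some (size q) ->
  exists p1 p2 z z', [/\ map val q = p1 ++ p2, directed_path u p1 z,
    directed_path z' p2 v & pi z = pi z'].
Proof.
elim: q u => [|e q IHq] u.
  by move=> /eqP uv _; exists [::], [::], u, v; split; rewrite /= ?eqxx.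
move=> uq duv; have dtl := geodesic_tail uq duv.
move: uq => /andP[/eqP su /IHq/(_ dtl)[p1 [p2 [z [z' [qE tz zv zz]]]]]].
case: (eqVneq (src (val e)) u) => [eu|eu].
  by exists (val e :: p1), p2, z, z'; rewrite /= qE eu eqxx.
case: (eqVneq z z') => [zz'|nzz].
  exists [::], (val e :: p1 ++ p2), u, (src (val e)).
  by split; rewrite /= ?qE ?eqxx //= (directed_path_cat tz) ?zz'.
(* With a second break at [u], both [u] and [z'] project to the merged vertex, and [p2] alone gives
   a path shorter than the geodesic. *)
have uz' : pi u = pi z'.
  by rewrite -su -zz (ct_proj_neq zz nzz); apply: ct_proj_neq eu; rewrite -su.
have : le_inf (dist (pi u) (pi v)) (Some (size p2)).
  by rewrite uz'; apply: le_inf_trans (ct_dist_le _ _) _; apply: dist_le_path.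
rewrite duv /= => qp2; have := congr1 size qE; rewrite size_map size_cat => sq.
by move: qp2; rewrite sq ltnNge leq_addl.
Qed.

Lemma geodesic_lift u v (q : seq (edge Qc)) : u \in S -> v \in S ->
  directed_path (pi u) q (pi v) -> dist (pi u) (pi v) = Some (size q) ->
  (size q <= l)%N -> directed_path u (map val q) v.
Proof.
move=> uS vS uq duv ql.
have [p1 [p2 [z [z' [qE tz zv zz]]]]] := geodesic_lift_upto uq duv.
have zz' : z = z'.
  by apply: good_glue tz zv zz _; rewrite // -qE ?e0_notin_val ?size_map.
by rewrite qE (directed_path_cat tz) ?zz'.
Qed.

Lemma good_dist u v : u \in S -> v \in S ->
  le_inf (dist (pi u) (pi v)) (Some l) -> dist u v = dist (pi u) (pi v).
Proof.
move=> uS vS; case duv: (dist (pi u) (pi v)) => [m|] // ml.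
have [q sq uq] := dist_geodesic duv; rewrite -sq in duv ml *.
have /dist_le_path := geodesic_lift uS vS uq duv ml.
rewrite size_map => h; apply: le_inf_anti h _; rewrite -duv; exact: ct_dist_le.
Qed.

Lemma good_length s : all (mem S) s ->
  le_inf (tuple_length (map pi s)) (Some l) ->
  tuple_length s = tuple_length (map pi s).
Proof.
elim: s => [|u [|v s] IHs] //= /andP[uS /andP[vS sS]].
rewrite -/(tuple_length (map pi (v :: s))) => /add_inf_le[dl sl].
by rewrite -/(tuple_length (v :: s)) IHs ?good_dist //= vS.
Qed.

(** A geodesic from [u'] to [v'] avoids [e0], since otherwise the distance would drop. Its image is
    a geodesic whose lift with endpoints [u] and [v] has the same edges; being nonempty, this walk
    determines its endpoints. *)
Lemma good_rigid_pair u v u' v' : u \in S -> v \in S -> u' != v' ->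
  pi u' = pi u -> pi v' = pi v -> dist u' v' = dist (pi u) (pi v) ->
  le_inf (dist (pi u) (pi v)) (Some l) -> u' = u /\ v' = v.
Proof.
move=> uS vS uv' uu vv; case duv: (dist (pi u) (pi v)) => [m|] // du'v' ml.
have [p sp up] := dist_geodesic du'v'.
have e0p : e0 \notin p.
  apply/negP => /(ct_dist_lt nonloop up)[n]; rewrite -/(pi u') -/(pi v').
  by rewrite uu vv duv sp /= ltnNge => /negP.
have [q qp] := ct_path nonloop up e0p; rewrite -/(pi u') -/(pi v') uu vv => uq.
have := geodesic_lift uS vS uq; rewrite -(size_map val) qp sp => /(_ duv ml).
case: p sp up {qp e0p} => [m0|e p _ /= /andP[/eqP su pv'] /andP[/eqP su' pv]].
  by case: (dist_pos uv'); rewrite du'v' -m0.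
by split; [rewrite -su | apply: directed_path_end pv' pv].
Qed.

(** Apply the rigidity of pairs to consecutive entries. At least two entries are required, since a
    single endpoint of [e0] is not determined by its image. *)
Lemma good_rigid s s' : (1 < size s)%N -> all (mem S) s ->
  map pi s' = map pi s -> sorted (fun v w => v != w) s' ->
  tuple_length s' = tuple_length (map pi s) ->
  le_inf (tuple_length (map pi s)) (Some l) -> s' = s.
Proof.
elim: s s' => [//|u [//|v s] IHs] [//|u' [//|v' s']] _.
move=> /andP[uS sS] mE /andP[uv' srt].
have [uu ss'] : pi u' = pi u /\ map pi (v' :: s') = map pi (v :: s) := cons_inj mE.
have [vv ss] : pi v' = pi v /\ map pi s' = map pi s := cons_inj ss'.
have -> : map pi [:: u, v & s] = [:: pi u, pi v & map pi s] by [].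
rewrite !tuple_length_cons.
have -> : pi v :: map pi s = map pi (v :: s) by [].
move=> eqd ll.
have h1 : le_inf (dist (pi u) (pi v)) (dist u' v') by rewrite -uu -vv; apply: ct_dist_le.
have h2 : le_inf (tuple_length (map pi (v :: s))) (tuple_length (v' :: s')).
  by rewrite -ss'; apply: ct_length_le.
have [d' l'] := add_inf_eq h1 h2 eqd ll.
have [dl sl] := add_inf_le ll; have /andP[vS _] := sS.
have [-> v'v] := good_rigid_pair uS vS uv' uu vv d' dl.
congr cons; move=> {mE eqd h2}; case: s IHs sS ss ss' ll l' sl => [|w s] IHs sS ss ss' ll l' sl.
  by case: s' {srt ss' l'} ss; rewrite // v'v.
exact: IHs.
Qed.

(** [w] lies on a geodesic from [pi u] to [pi v]. This geodesic lifts, and [w'] is the vertex at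
    which the lift is cut; it need not be given in [S]. *)
Lemma good_insert_pair u v (w : vertex Qc) : u \in S -> v \in S ->
  add_inf (dist (pi u) w) (dist w (pi v)) = dist (pi u) (pi v) ->
  le_inf (dist (pi u) (pi v)) (Some l) ->
  exists w', [/\ pi w' = w, dist u w' = dist (pi u) w & dist w' v = dist w (pi v)].
Proof.
move=> uS vS; case duv: (dist (pi u) (pi v)) => [m|] //.
case du: (dist _ w) => [m1|] //; case dv: (dist w _) => [m2|] // [mE] ml.
have [q1 sq1 uq1] := dist_geodesic du; have [q2 sq2 q2v] := dist_geodesic dv.
have sq : size (q1 ++ q2) = m by rewrite size_cat sq1 sq2.
have uq := directed_path_cat uq1 q2v.
have := geodesic_lift uS vS uq; rewrite sq => /(_ duv ml).
rewrite map_cat => /directed_path_split[w' uw' w'v].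
have piw' : pi w' = w.
  have [q qE uq'] := ct_path nonloop uw' (e0_notin_val q1).
  rewrite (inj_map val_inj qE) in uq'; exact: directed_path_end uq' uq1.
exists w'; split=> //; apply: le_inf_anti.
- by rewrite -sq1 -(size_map val); apply: dist_le_path.
- by rewrite -du -piw'; apply: ct_dist_le.
- by rewrite -sq2 -(size_map val); apply: dist_le_path.
- by rewrite -dv -piw'; apply: ct_dist_le.
Qed.

(** If a length-preserving deletion of [s] lifts to [S], so does [s]. This controls the terms of the
    differential in [descended_cocycle]. *)
Lemma good_insert i (s : seq (vertex Qc)) t : (i.+2 < size s)%N ->
  del i.+1 s = map pi t -> all (mem S) t ->
  tuple_length (del i.+1 s) = tuple_length s ->
  le_inf (tuple_length s) (Some l) ->
  exists t', [/\ map pi t' = s, del i.+1 t' = t & tuple_length t' = tuple_length s].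
Proof.
elim: i s t => [|i IHi] [//|a [//|w s]] t.
  case: s => [//|b s] _; rewrite /del /=; case: t => [//|u [//|v t]] [-> -> ->].
  move=> /andP[uS vtS]; have /andP[vS _] := vtS.
  have -> : pi v :: map pi t = map pi (v :: t) by [].
  rewrite -/(tuple_length (map pi (v :: t))) add_infA => /esym eqd.
  rewrite eqd => ll; have [duv lt] := add_inf_le ll.
  have [d1 _] := add_inf_eq (dist_triangle _ _ _) (le_inf_refl _) eqd ll.
  have [w' [piw' d2 d3]] := good_insert_pair uS vS d1 duv.
  exists [:: u, w', v & t]; split; rewrite /= ?piw' ?drop0 //.
  rewrite -/(tuple_length (v :: t)) -/(tuple_length (map pi (v :: t))).
  by rewrite good_length // d2 d3 add_infA.
case: t => [|u [|v t]] //.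
rewrite ltnS => si; have -> : del i.+2 [:: a, w & s] = a :: del i.+1 (w :: s) by [].
move=> mE /andP[uS tS].
have [-> dE] : a = pi u /\ del i.+1 (w :: s) = map pi (v :: t) := cons_inj mE.
have dw : del i.+1 (w :: s) = w :: del i s by [].
rewrite {1}dw !tuple_length_cons -dw => eqd ll.
have [_ lws] := add_inf_le ll.
have dl : le_inf (tuple_length (del i.+1 (w :: s))) (tuple_length (w :: s)).
  exact: length_del.
have [_ lE] := add_inf_eq (le_inf_refl _) dl (esym eqd) (ltac:(rewrite eqd; exact: ll)).
have [[|w' t'] [t'E t'd t'l]] := IHi (w :: s) (v :: t) si dE tS (esym lE) lws => //.
have [w'v _] : w' = v /\ del i t' = t := cons_inj t'd.
have [piw' _] : pi w' = w /\ map pi t' = s := cons_inj t'E.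
exists [:: u, w' & t']; split; first by rewrite -t'E.
  by rewrite -t'd.
rewrite !tuple_length_cons t'l; congr add_inf.
have [+ _] := add_inf_le ll; rewrite -piw' => /good_dist -> //.
by rewrite w'v; case/andP: tS.
Qed.
End GoodEdge.

(** * Cocycles with prescribed endpoints *)

Section Ends.
Variable T : eqType.
Implicit Types (a b : T) (s : seq T).

(** The default values matter only for the empty sequence, and generators are nonempty. *)
Definition has_ends a b s : bool := (head b s == a) && (last a s == b).

Lemma head_del x i s : (i.+2 < size s)%N -> head x (del i.+1 s) = head x s.
Proof. by case: s. Qed.

Lemma last_del x i s : (i.+2 < size s)%N -> last x (del i.+1 s) = last x s.
Proof.
elim: i s x => [|i IHi] [|u [|v s]] x //=; first by case: s.
by rewrite ltnS => /(IHi (v :: s) u).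
Qed.

Lemma has_ends_del a b i s : (i.+2 < size s)%N ->
  has_ends a b (del i.+1 s) = has_ends a b s.
Proof. by move=> si; rewrite /has_ends head_del // last_del. Qed.
End Ends.

Section EndsComponent.
Variables (R : comPzRingType) (Q : quiver) (k l : nat).
Implicit Type z : dual (MC R Q k l).

Definition ends_component (a b : vertex Q) z : dual (MC R Q k l) :=
  lin_ext (fun t : generator Q k l =>
    if has_ends a b (val (val t)) then z (delta R t) else 0).

Lemma ends_component_basis a b z s : size s = k.+1 ->
  ends_component a b z (basis R k l s) =
    if has_ends a b s then z (basis R k l s) else 0.
Proof.
move=> sz; have [adm|nadm] := boolP (admissible l s); last first.
  by rewrite basis0 // !linear0; case: ifP.
have [t <-] := basis_generator sz adm.
by rewrite basis_delta; apply: lin_ext_delta.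
Qed.

Lemma ends_component_cocycle a b z :
  coboundary z = 0 -> coboundary (ends_component a b z) = 0.
Proof.
move=> z0; apply: dual_ffun_eq => t; rewrite -basis_delta; set s := val (val t).
have sz : size s = k.+2 by rewrite size_tuple.
have adm : admissible l s := valP t.
(* Interior deletions keep the endpoints, so taking the component commutes with the coboundary. *)
transitivity (if has_ends a b s then coboundary z (basis R k.+1 l s) else 0); last first.
  by rewrite z0; case: ifP.
rewrite /coboundary /dual_map /= differential_basis // !linear_sum.
rewrite -[RHS]/(if _ then _ else _).
have del_ends i : (1 <= i < k.+1)%N ->
    ends_component a b z (basis R k l (del i s)) =
    if has_ends a b s then z (basis R k l (del i s)) else 0.
  case: i => // i /andP[_ ik]; rewrite ends_component_basis; last first.
    by rewrite size_del sz // ltnW.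
  by rewrite has_ends_del // sz.
case: ifP del_ends => ab del_ends.
  by apply: eq_big_nat => i ik; rewrite !linearZ /= del_ends.
by rewrite big_nat big1 // => i ik; rewrite linearZ /= del_ends // scaler0.
Qed.

Lemma ends_component_sum z :
  z = \sum_(ab : vertex Q * vertex Q) ends_component ab.1 ab.2 z.
Proof.
apply: dual_ffun_eq => t; rewrite -basis_delta; set s := val (val t).
have sz : size s = k.+1 by rewrite size_tuple.
have [v0 [s' sE]] : exists v s', s = v :: s' by case: s sz => // v s' _; exists v, s'.
have evD : forall (I : finType) (h : I -> dual (MC R Q k l)) x,
    (\sum_i h i) x = \sum_i h i x.
  move=> I h x; apply: (big_morph (fun h : dual (MC R Q k l) => h x)) => //.
rewrite evD (bigD1 (v0, last v0 s')) //= big1 => [|[a b] /= ab].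
  by rewrite addr0 ends_component_basis // /has_ends sE /= !eqxx.
rewrite ends_component_basis // /has_ends sE /=; case: ifP => // /andP[/eqP va /eqP lb].
by rewrite -va -lb eqxx in ab.
Qed.
End EndsComponent.

(** * Descent of cocycles along the contraction of a good edge *)

Section Descent.
Variables (R : comPzRingType) (Q : quiver) (e0 : edge Q).
Hypothesis nonloop : src e0 != tgt e0.
Variables (k l : nat) (a b : vertex Q).
Hypothesis l_pos : (0 < l)%N.
Hypothesis good : ~ bad_edge (walk_vertices a b l) l e0.
Local Notation Qc := (contracted nonloop).
Local Notation f := (edge_contraction nonloop).

Lemma map_vmap_ct s : map (vmap f) s = map (ct_proj nonloop) s.
Proof. exact/eq_map/vmap_ct. Qed.

Lemma ends_walk_vertices s : admissible l s -> has_ends a b s ->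
  all (mem (walk_vertices a b l)) s.
Proof.
case: s => [//|v s] /andP[_ /eqP ls] /andP[/eqP /= va /eqP /= lb].
by rewrite -va -lb; apply: walk_vertices_tuple.
Qed.

Lemma ends_admissible s : admissible l s -> has_ends a b s ->
  admissible l (map (vmap f) s).
Proof.
move=> adm ab; apply: admissible_map => //; have /andP[_ /eqP ls] := adm.
rewrite map_vmap_ct -(good_length (nonloop := nonloop) good) //.
  exact: ends_walk_vertices.
by rewrite -ls; apply: ct_length_le.
Qed.

Lemma ends_rigid s s' : admissible l s -> has_ends a b s -> admissible l s' ->
  map (vmap f) s' = map (vmap f) s -> s' = s.
Proof.
move=> adm ab /andP[srt /eqP ls'] ss'.
have /andP[_ /eqP lfs] := ends_admissible adm ab.
rewrite !map_vmap_ct in ss' lfs; apply: (good_rigid (nonloop := nonloop) good) => //.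
(* A tuple with a single entry has length 0, so positivity of [l] gives two entries. *)
- have /andP[_] := adm; case: (s) => [|v [|w s1]] //=; rewrite eq_sym => /eqP[l0];
  by move: l_pos; rewrite l0.
- exact: ends_walk_vertices.
- by rewrite lfs.
- by rewrite lfs /=.
Qed.

Variable z : dual (MC R Q k l).
Hypothesis z_cocycle : coboundary z = 0.

(** By [ends_rigid] the sum has at most one term: the value of [z] at the unique lift with ends [a]
    and [b], or 0 if there is none. *)
Definition descended : dual (MC R Qc k l) :=
  lin_ext (fun t' : generator Qc k l =>
    \sum_(t : generator Q k l | has_ends a b (val (val t)) &&
        (map (vmap f) (val (val t)) == val (val t'))) z (delta R t)).

Lemma descended_basis s : size s = k.+1 -> admissible l s ->
  descended (basis R k l s) =
  \sum_(t : generator Q k l | has_ends a b (val (val t)) &&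
    (map (vmap f) (val (val t)) == s)) z (delta R t).
Proof.
move=> sz adm; have [t <-] := basis_generator sz adm.
by rewrite basis_delta /descended /= lin_ext_delta.
Qed.

(** Tuples from [a] to [b] stay admissible in the contracted quiver, and no other admissible tuple
    has the same image as one of them. *)
Lemma pull_descended : pull f descended = ends_component a b z.
Proof.
apply: dual_ffun_eq => t; rewrite -basis_delta; set s := val (val t).
have sz : size s = k.+1 by rewrite size_tuple.
have adm : admissible l s := valP t.
rewrite ends_component_basis // /pull /dual_map /= push_basis // adm.
have [fadm|nfadm] := boolP (admissible l (map (vmap f) s)); last first.
  rewrite basis0 // linear0; case: ifP => // ab.
  by rewrite ends_admissible in nfadm.
rewrite descended_basis ?size_map //.
have rigid (u : generator Q k l) : has_ends a b (val (val u)) ->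
    map (vmap f) (val (val u)) = map (vmap f) s -> u = t.
  by move=> uab us; do 2!apply: val_inj; apply/esym/ends_rigid => //; apply: (valP u).
case: ifP => ab; last first.
  by apply: big_pred0 => u; apply/andP => -[uab /eqP us];
    move: (uab); rewrite (rigid u uab us) -/s ab.
rewrite (big_pred1 t) ?basis_delta // => u; apply/andP/eqP => [[uab /eqP us]|->].
  exact: rigid.
by rewrite ab eqxx.
Qed.

Lemma descended_cocycle : coboundary descended = 0.
Proof.
apply: dual_ffun_eq => t'; rewrite -basis_delta; set s' := val (val t').
have sz' : size s' = k.+2 by rewrite size_tuple.
have adm' : admissible l s' := valP t'.
rewrite /coboundary /dual_map /=.
(* If [s'] lifts to a tuple from [a] to [b], the claim follows from the cocycle condition on [Q],
   because pushing forward is a chain map. *)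
case: (pselect (exists s, [/\ size s = k.+2, admissible l s, has_ends a b s
    & map (vmap f) s = s'])) => [[s [sz adm ab fs]]|nolift].
  have -> : basis R k.+1 l s' = push f (basis R k.+1 l s).
    by rewrite push_basis // adm fs.
  rewrite -push_differential.
  have -> : descended (push f (differential (basis R k.+1 l s))) =
      coboundary (ends_component a b z) (basis R k.+1 l s).
    by rewrite -pull_descended.
  by rewrite ends_component_cocycle.
(* If [s'] has no such lift, neither has any of its admissible deletions, by [good_insert], so each
   term vanishes. *)
rewrite differential_basis // linear_sum big_nat big1 // => -[//|i] /andP[_ ik].
have is' : (i.+2 < size s')%N by rewrite sz'.
have sz_del : size (del i.+1 s') = k.+1 by rewrite size_del sz' // ltnW.
rewrite linearZ /=; have [adm|nadm] := boolP (admissible l (del i.+1 s')); last first.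
  by rewrite basis0 // linear0 scaler0.
rewrite descended_basis // big_pred0 ?scaler0 // => t; apply/andP => -[ab /eqP ts].
case: nolift; have admt := valP t.
have /andP[_ /eqP ld] := adm; have /andP[srt' /eqP ls'] := adm'.
have [||||s [fs ds lens]] := @good_insert _ _ nonloop _ _ good i s' (val (val t)) is'.
- by rewrite -ts map_vmap_ct.
- exact: ends_walk_vertices.
- by rewrite ld.
- by rewrite ls' /=.
exists s; split.
- by rewrite -sz' -fs size_map.
- rewrite /admissible lens ls' eqxx andbT; move: srt'; rewrite -fs sorted_map.
  by apply: sub_sorted => u v; apply: contra_neq => ->.
- by rewrite -(has_ends_del a b (i := i)) ?ds // -(size_map (ct_proj nonloop)) fs.
- by rewrite map_vmap_ct.
Qed.
End Descent.

(** * Isomorphism classes of small quivers *)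

Section Isomorphism.
Variables (Q' Q : quiver) (alpha : vertex Q' -> vertex Q) (beta : edge Q' -> edge Q).
Hypotheses (alpha_bij : bijective alpha) (beta_bij : bijective beta).
Hypothesis alpha_src : forall e, alpha (src e) = src (beta e).
Hypothesis alpha_tgt : forall e, alpha (tgt e) = tgt (beta e).

Definition iso_cell (c : cell Q') : cell Q :=
  match c with inl v => inl (alpha v) | inr e => inr (beta e) end.

Fact iso_vertexP : (iso_cell @` range inl = range inl)%classic.
Proof.
have [alpha' _ alphaK] := alpha_bij.
apply/seteqP; split=> [_ [_ [v _ <-] <-]|_ [v _ <-]]; first by exists (alpha v).
by exists (inl (alpha' v)); [exists (alpha' v) | rewrite /= alphaK].
Qed.

Fact iso_edgeP : edge_compatible iso_cell.
Proof. by move=> e /=; rewrite alpha_src alpha_tgt. Qed.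

Fact iso_bijP : set_bij (iso_cell @^-1` range inr)%classic (range inr) iso_cell.
Proof.
have [beta' _ betaK] := beta_bij; have beta_inj := bij_inj beta_bij.
split=> [c //|[v|e] [v'|e']|_ [e _ <-]]; rewrite ?inE /=.
- by move=> [].
- by move=> [].
- by move=> _ [].
- by move=> _ _ [/beta_inj ->].
- by exists (inr (beta' e)); rewrite /= betaK //; exists e.
Qed.

Fact iso_fiberP v : directed_tree (fiber iso_edgeP v).
Proof.
apply/andP; split.
  apply/fiber_connectedP; split=> [|u w [uv] [wv]].
    by have [alpha' _ alphaK] := alpha_bij; exists (alpha' v); rewrite /= alphaK.
  by rewrite (bij_inj alpha_bij (etrans uv (esym wv))).
apply/fiber_acyclicP => c cv _; apply/ffunP=> e; rewrite ffunE.
by apply/eqP; apply: contraT => /cv.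
Qed.

Definition iso_contraction : contraction Q' Q :=
  Contraction iso_vertexP iso_bijP iso_fiberP.
End Isomorphism.

(** Vertices and edges are numbered, and the function records the source and target of each edge. A
    quiver may have several codes. *)
Definition quiver_code (B : nat) : finType :=
  {n : 'I_B.+1 & {m : 'I_B.+1 & {ffun 'I_m -> 'I_n * 'I_n}}}.

Definition coded (n m : nat) (st : {ffun 'I_m -> 'I_n * 'I_n}) (Q : quiver) : Prop :=
  exists (nu : vertex Q -> 'I_n) (eps : edge Q -> 'I_m),
    [/\ bijective nu, bijective eps & forall e, st (eps e) = (nu (src e), nu (tgt e))].

Lemma coded_enum (Q : quiver) :
  exists st : {ffun 'I_#|edge Q| -> 'I_#|vertex Q| * 'I_#|vertex Q|}, coded st Q.
Proof.
exists [ffun i => (enum_rank (src (enum_val i)), enum_rank (tgt (enum_val i)))].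
exists enum_rank, enum_rank; split=> [||e]; try exact: enum_rank_bij.
by rewrite ffunE enum_rankK.
Qed.

Definition has_code B (t : quiver_code B) (Q : quiver) : Prop :=
  coded (tagged (tagged t)) Q.

Lemma has_code_exists B (Q : quiver) : (#|vertex Q| <= B)%N -> (#|edge Q| <= B)%N ->
  exists t : quiver_code B, has_code t Q.
Proof.
rewrite -ltnS => Vn; rewrite -ltnS => Em; have [st stP] := coded_enum Q.
by exists (existT _ (Ordinal Vn) (existT _ (Ordinal Em) st)).
Qed.

Lemma has_code_iso B (t : quiver_code B) (Q P : quiver) : has_code t Q -> has_code t P ->
  exists (f : contraction Q P) (h : contraction P Q),
    comp_contraction h f = id_contraction Q.
Proof.
move=> [nuQ [epsQ [[nuQ' nuQK nuQK'] [epsQ' epsQK epsQK'] stQ]]].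
move=> [nuP [epsP [[nuP' nuPK nuPK'] [epsP' epsPK epsPK'] stP]]].
have stE e e' : epsP e' = epsQ e ->
    nuP (src e') = nuQ (src e) /\ nuP (tgt e') = nuQ (tgt e).
  by move=> ee; have := stP e'; rewrite ee stQ => -[-> ->].
pose al := nuP' \o nuQ; pose al' := nuQ' \o nuP.
pose be := epsP' \o epsQ; pose be' := epsQ' \o epsP.
have alK : cancel al al' by move=> v; rewrite /al' /al /= nuPK' nuQK.
have alK' : cancel al' al by move=> v; rewrite /al' /al /= nuQK' nuPK.
have beK : cancel be be' by move=> e; rewrite /be' /be /= epsPK' epsQK.
have beK' : cancel be' be by move=> e; rewrite /be' /be /= epsQK' epsPK.
have al_st e : al (src e) = src (be e) /\ al (tgt e) = tgt (be e).
  have [s1 s2] := stE e (be e) (epsPK' _).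
  by rewrite /al /= -s1 -s2 !nuPK.
have al_st' e : al' (src e) = src (be' e) /\ al' (tgt e) = tgt (be' e).
  by have [s1 s2] := al_st (be' e); rewrite !beK' in s1 s2; rewrite -s1 -s2 !alK.
exists (iso_contraction (Bijective alK alK') (Bijective beK beK')
  (fun e => (al_st e).1) (fun e => (al_st e).2)).
exists (iso_contraction (Bijective alK' alK) (Bijective beK' beK)
  (fun e => (al_st' e).1) (fun e => (al_st' e).2)).
by apply: contractionP => -[v|e] /=; rewrite ?alK ?beK.
Qed.

(** * Reduction to small quivers *)

(** If some vertex is not an endpoint of an edge, connectedness makes it the only vertex; this case
    accounts for the successor. *)
Lemma card_vertex_connected (Q : quiver) : connected Q ->
  (#|vertex Q| <= (2 * #|edge Q|).+1)%N.
Proof.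
move=> /andP[_ /'forall_forallP cn].
pose D : {set vertex Q} := ([set src e | e : edge Q] :|: [set tgt e | e : edge Q])%SET.
have Dle : (#|D| <= 2 * #|edge Q|)%N.
  rewrite mul2n -addnn; apply: leq_trans (leq_card_setU _ _) _.
  by apply: leq_add; apply: leq_imset_card.
case: (pselect (forall v, v \in D)) => [allD|nD].
  apply: leqW; apply: leq_trans Dle; apply/subset_leq_card/fintype.subsetP => v _.
  exact: allD.
have {nD} [v vD] : exists v, v \notin D.
  by apply: contrapT => h; apply: nD => v; apply: contraT => vD; case: h; exists v.
suff /eq_card -> : vertex Q =i pred1 v by rewrite card1.
move=> w; rewrite !inE; apply/esym/eqP; have /connectP[[|u p] //=] := cn v w.
move=> /andP[/existsP[e vu] _] _; case/negP: vD; rewrite !inE.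
by case/orP: vu => /andP[/eqP su /eqP tu]; rewrite -?su -?tu imset_f ?orbT.
Qed.

Lemma exists_good_edge (Q : quiver) (S : {set vertex Q}) l :
  (l.+1 * (genus Q + #|S|) < #|edge Q|)%N ->
  exists e, src e != tgt e /\ ~ bad_edge S l e.
Proof.
move=> big; apply: contrapT => nogood.
suff : (#|edge Q| <= l.+1 * (genus Q + #|S|))%N by rewrite leqNgt big.
rewrite -cardsT; apply: bad_edge_bound => e _; apply: contrapT => ebad.
by apply: nogood; exists e; split=> //; apply/eqP => eloop; apply: ebad; left.
Qed.

(** * Cochains of length zero *)

Lemma generator_length0 (Q : quiver) k : generator Q k.+1 0 -> False.
Proof.
case=> -[[|u [|v s]] // sz] /andP[/= /andP[uv _]].
rewrite -/(tuple_length (v :: s)).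
case d: (dist u v) => [[|m]|] //; first by case: (dist_pos uv).
by case: tuple_length.
Qed.

Lemma cocycle_length0 (R : comPzRingType) (Q : quiver) (h : dual (MC R Q 0 0)) :
  coboundary h = 0.
Proof. by apply: dual_ffun_eq => t; case: (generator_length0 t). Qed.

Lemma admissible1 (Q : quiver) (v : vertex Q) : admissible 0 [:: v].
Proof. by []. Qed.

Lemma dual_length0_eq (R : comPzRingType) (Q : quiver) (h h' : dual (MC R Q 0 0)) :
  (forall v, h (basis R 0 0 [:: v]) = h' (basis R 0 0 [:: v])) -> h = h'.
Proof.
move=> hh; apply: dual_ffun_eq => t; rewrite -basis_delta; set s := val (val t).
have : size s = 1%N by rewrite size_tuple.
by case: s => [|v [|]].
Qed.

Definition vertex_cochain (R : comPzRingType) (Q : quiver) (c : vertex Q -> R^o) :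
  dual (MC R Q 0 0) :=
  lin_ext (fun t : generator Q 0 0 => c (thead (val t))).

Lemma vertex_cochainE (R : comPzRingType) (Q : quiver) (c : vertex Q -> R^o) v :
  vertex_cochain c (basis R 0 0 [:: v]) = c v.
Proof.
have [t tv] := @basis_generator Q 0 0 [:: v] (erefl _) (admissible1 v).
rewrite -{1}tv basis_delta /vertex_cochain /= lin_ext_delta.
by rewrite /thead (tnth_nth v) tv.
Qed.

(** Length-0 cochains in degree 0 are functions on the vertices, and those agreeing at the ends of
    [e] factor through the contraction. *)
Lemma pull_vertex_cochain (R : comPzRingType) (Q : quiver) (e : edge Q)
    (nonloop : src e != tgt e) (h : dual (MC R Q 0 0)) :
  h (basis R 0 0 [:: src e]) = h (basis R 0 0 [:: tgt e]) ->
  exists h' : dual (MC R (contracted nonloop) 0 0),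
    pull (edge_contraction nonloop) h' = h.
Proof.
move=> hst; pose c (v : vertex (contracted nonloop)) := h (basis R 0 0 [:: val v]).
exists (vertex_cochain c); apply: dual_length0_eq => v.
rewrite -[LHS]/(vertex_cochain c (push (edge_contraction nonloop) _)).
rewrite push_basis // admissible1 [map _ _]/= vertex_cochainE vmap_ct /c /=.
by case: eqP => [->|].
Qed.

(** Some endpoint [q] of [e1] is not on [e2]. Take for [h2] a function supported at [q] that carries
    the difference of [h] along [e1]; it vanishes at both ends of [e2]. *)
Lemma split_length0 (R : comPzRingType) (Q : quiver) (e1 e2 : edge Q)
    (h : dual (MC R Q 0 0)) :
  src e1 != tgt e1 -> src e2 != tgt e2 ->
  ~~ ((src e2 \in [set src e1; tgt e1]%SET) && (tgt e2 \in [set src e1; tgt e1]%SET)) ->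
  exists h1 h2, [/\ h = h1 + h2,
    h1 (basis R 0 0 [:: src e1]) = h1 (basis R 0 0 [:: tgt e1]) &
    h2 (basis R 0 0 [:: src e2]) = h2 (basis R 0 0 [:: tgt e2])].
Proof.
move=> nl1 nl2 e12.
have [q [q' [qq' qe2]]] : exists q q', [\/ (q, q') = (src e1, tgt e1) |
    (q, q') = (tgt e1, src e1)] /\ ((q == src e2) = false /\ (q == tgt e2) = false).
  have [s1|s1] := boolP ((src e1 == src e2) || (src e1 == tgt e2)).
    exists (tgt e1), (src e1); split; first by right.
    move: e12; rewrite !inE !(eq_sym _ (tgt e1)) !(eq_sym _ (src e1)).
    case/orP: s1 => /eqP s1.
      rewrite -s1 eqxx /= negb_or => /andP[_ /negPf ->].
      by rewrite eq_sym (negPf nl1).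
    rewrite -s1 eqxx andbT negb_or => /andP[_ /negPf ->].
    by rewrite eq_sym (negPf nl1).
  exists (src e1), (tgt e1); split; first by left.
  by move: s1; rewrite negb_or => /andP[/negPf -> /negPf ->].
pose H v := h (basis R 0 0 [:: v]).
pose h2 := vertex_cochain (fun v => if v == q then H q - H q' else 0).
have q'q : q' != q by case: qq' => -[-> ->]; rewrite // eq_sym.
exists (h - h2), h2; split; first by rewrite subrK.
  have E v : (h - h2) (basis R 0 0 [:: v]) = H v - (if v == q then H q - H q' else 0).
    by rewrite -[RHS]/(H v - _) -(vertex_cochainE (fun v => if v == q then H q - H q' else 0)).
  have : (h - h2) (basis R 0 0 [:: q]) = (h - h2) (basis R 0 0 [:: q']).
    by rewrite !E eqxx (negPf q'q) subr0 opprB addrC subrK.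
  by case: qq' => -[-> ->].
rewrite !vertex_cochainE; case: qe2 => qs qt.
by rewrite ![_ == q]eq_sym qs qt.
Qed.

(** * From cohomology classes to cocycles, and the induction on edges *)

Section Assembly.
Variables (R : comPzRingType) (k l g : nat).

Section Classes.
Variables (W : lmodType R) (Z B : submodule W) (Y : submodule (subquotient Z B)).

(** Working with representatives allows a class to be decomposed on the level of cochains. *)
Definition class_preimage : submodule W.
Proof.
apply: (@Submodule _ _ (fun z =>
  exists2 c : submod_type Z, val c = z & Y (subquot_class B c))).
- exists 0 => //; have -> : subquot_class B (0 : submod_type Z) = 0.
    by rewrite /subquot_class linear0.
  exact: submod0.
- move=> _ _ [c <- Yc] [d <- Yd]; exists (c + d); first by rewrite raddfD.
  by rewrite -[c]scale1r subquot_class_linear scale1r; apply: submodD.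
- move=> a _ [c <- Yc]; exists (a *: c); first by rewrite linearZ.
  rewrite -[a *: c]addr0 subquot_class_linear.
  have -> : subquot_class B (0 : submod_type Z) = 0 by rewrite /subquot_class linear0.
  by rewrite addr0; apply: submodZ.
Defined.

Lemma class_preimageP (c : submod_type Z) :
  class_preimage (val c) <-> Y (subquot_class B c).
Proof.
by split=> [[d /val_inj ->]|Yc] //; exists c.
Qed.
End Classes.

Lemma MH_fg (Q : quiver) : noetherian R -> submod_fg (full_submod (MH R Q k l)).
Proof.
move=> Rn; have [I [x [xZ xgen]]] := submod_fg_dual (cocycles R Q k l) Rn.
pose c i : submod_type (cocycles R Q k l) :=
  SubmodElt (introT (submod_predP (cocycles R Q k l) (x i)) (xZ i)).
exists I, (fun i => subquot_class (coboundaries R Q k l) (c i)); split=> // Y Yc y _.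
elim/subquot_ind: y => z; apply/class_preimageP.
apply: xgen => [i|]; first exact/(class_preimageP Y (c i)).
exact/submod_predP/(valP z).
Qed.

Variable N : subfunctor (MH_module R k l g).

Definition cocycle_in (Q : cquiver g) : submodule (dual (MC R Q k l)) :=
  class_preimage (N Q : submodule (subquotient (cocycles R Q k l) (coboundaries R Q k l))).

Lemma cocycle_in_pull (Q : cquiver g) (e : edge Q) (nonloop : src e != tgt e)
    (z : dual (MC R (contracted nonloop) k l)) :
  (forall y, N (ccontracted nonloop) y) -> coboundary z = 0 ->
  cocycle_in Q (pull (edge_contraction nonloop) z).
Proof.
move=> Nfull z0; pose Qc := ccontracted nonloop.
pose c : submod_type (cocycles R Qc k l) :=
  SubmodElt (introT (submod_predP (cocycles R Qc k l) z) z0).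
exists (submod_map (@pull_cocycles R _ _ (edge_contraction nonloop) k l) c) => //.
rewrite -MH_mapE.
exact: (@subf_map _ _ _ N Qc Q (edge_contraction nonloop)).
Qed.

End Assembly.

(** This is the bound on bad edges for a set of at most [l * (g + 2) + 2] vertices. That size covers
    [walk_vertices] and, when [l] is 0, the two endpoints of an edge. *)
Definition edge_bound (l g : nat) : nat := l.+1 * (g + (l * (g + 2)).+2).

Lemma large_quiver (R : comPzRingType) (k l g : nat)
    (N : subfunctor (MH_module R k l g)) (Q : cquiver g) :
  (edge_bound l g < #|edge Q|)%N ->
  (forall (e : edge Q) (nonloop : src e != tgt e) y, N (ccontracted nonloop) y) ->
  forall y, N Q y.
Proof.
move=> large Nct; elim/subquot_ind => c; apply/class_preimageP; rewrite -/(cocycle_in N Q).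
have : coboundary (val c) = 0 by apply/(submod_predP (cocycles R Q k l))/(valP c).
move: (val c) => {c} z z0.
have good (S : {set vertex Q}) : (#|S| <= (l * (g + 2)).+2)%N ->
    exists e : edge Q, src e != tgt e /\ ~ bad_edge S l e.
  move=> Sle; apply: exists_good_edge; apply: leq_ltn_trans large.
  by rewrite leq_mul2l leq_add ?orbT // cquiver_genus.
have [l0|l0] := posnP l; last first.
  (* The edge to contract is chosen separately for each pair [(a, b)]. *)
  rewrite (ends_component_sum z); apply: submod_sum => -[a b] _ /=.
  have [|e [nl egood]] := good (walk_vertices a b l).
    apply: leqW; apply: leq_trans (card_walk_vertices a b l) _.
    by rewrite ltnS leq_mul2l leq_add2r cquiver_genus orbT.
  rewrite -(pull_descended nl l0 egood); apply: cocycle_in_pull; first exact: Nct.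
  exact: descended_cocycle.
(* In length 0 every generator is a single vertex, so only [k = 0] remains. *)
subst l; case: k => [|k] in N Nct z z0 *; last first.
  have -> : z = 0 by apply: dual_ffun_eq => t; case: (generator_length0 t).
  exact: submod0.
have [|e1 [nl1 _]] := good finset.set0; first by rewrite cards0.
pose S : {set vertex Q} := [set src e1; tgt e1]%SET.
have [|e2 [nl2 good2]] := good S; first by rewrite cards2 ltnS leq_b1.
(* An edge joining two vertices of [S] is bad, with two empty walks as witnesses. *)
have e12 : ~~ ((src e2 \in S) && (tgt e2 \in S)).
  apply/negP => /andP[sS tS]; apply: good2; right.
  exists (src e2), (tgt e2), (src e2), (tgt e2), [::], [::].
  by split; rewrite /= ?sS ?tS //; left.
have [h1 [h2 [-> h1e h2e]]] := split_length0 z nl1 nl2 e12.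
have [h1' <-] := pull_vertex_cochain nl1 h1e.
have [h2' <-] := pull_vertex_cochain nl2 h2e.
by apply: submodD; apply: cocycle_in_pull; rewrite ?cocycle_length0 //; apply: Nct.
Qed.

Lemma subfunctor_full (R : comPzRingType) (k l g B : nat)
    (N : subfunctor (MH_module R k l g)) :
  ((2 * edge_bound l g).+1 <= B)%N ->
  (forall (Q : cquiver g) (t : quiver_code B), has_code t Q ->
    exists2 P : cquiver g, has_code t P & forall y, N P y) ->
  forall (Q : cquiver g) y, N Q y.
Proof.
move=> leB Ncode Q; have [n] := ubnP #|edge Q|; elim: n Q => // n IHn Q.
rewrite ltnS => Qn; have [small|large] := leqP #|edge Q| (edge_bound l g).
  have leB' : ((2 * #|edge Q|).+1 <= B)%N.
    by apply: leq_trans leB; rewrite ltnS leq_mul2l small.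
  have [||t tQ] := @has_code_exists B Q.
  - by apply: leq_trans leB'; apply: card_vertex_connected; apply: cquiver_connected.
  - by apply: leq_trans leB'; rewrite mul2n -addnn leqW ?leq_addr.
  have [P tP NP] := Ncode Q t tQ; have [f [h hf]] := has_code_iso tQ tP.
  (* [y] is the pull-back along [f] of an element at [P], where [N] is full. *)
  move=> y; have : MH_map (comp_contraction h f) y = y by rewrite hf MH_map_id.
  by rewrite MH_map_comp => <-; apply: (@subf_map _ _ _ N P Q f).
apply: large_quiver large _ => e nl; apply: IHn.
exact: leq_trans (card_contracted_edge nl) Qn.
Qed.

Theorem theorem5p4 (R : comPzRingType) (R_noetherian : noetherian R)
    (k l g : nat) :
  finitely_generated (MH_module R k l g).
Proof.
(* [B] bounds both the edges and the vertices of a connected quiver with at most [edge_bound l g]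
   edges. *)
pose B := (2 * edge_bound l g).+1.
(* Only the codes of connected quivers of genus at most [g] receive a representative. *)
pose realized (t : quiver_code B) : bool := `[< exists Q : cquiver g, has_code t Q >].
pose T : finType := {t | realized t}.
have TP (t : T) : exists Q : cquiver g, has_code (val t) Q by apply/asboolP/(valP t).
pose s t := projT1 (cid (TP t)).
have sP t : has_code (val t) (s t) := projT2 (cid (TP t)).
apply: (@finitely_generated_criterion _ R (MH_module R k l g) T s) => [t|N Ns].
  exact: MH_fg.
apply: (@subfunctor_full R k l g B) => // Q t tQ.
have tr : realized t by apply/asboolP; exists Q.
by exists (s (Sub t tr)); [apply: (sP (Sub t tr)) | apply: Ns].
Qed.
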